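(* Let $X$ be a complex Banach space and let $T \in \mathcal{B}(X)$ be a power-bounded operator with $\sigma(T) \cap \mathbb{T} \subseteq \{1\}$. If $m\colon (0,\pi] \to (0,\infty)$ is a continuous, non-increasing function such that $$\|R(e^{i\theta}, T)\| \leq m(|\theta|), \qquad |\theta| \in (0,\pi],$$ then, for every $c \in (0,1)$, $$\|T^n(I-T)\| = O\big(m_{\log}^{-1}(cn)\big), \qquad n \to \infty.$$
   Context: $\mathcal{B}(X)$ is the space of bounded linear operators on $X$, $\sigma(T)$ is the spectrum of $T$, $\mathbb{T}=\{\lambda\in\mathbb{C}:|\lambda|=1\}$, and $R(\lambda,T)=(\lambda I-T)^{-1}$ for $\lambda\in\mathbb{C}\setminus\sigma(T)$. $T$ is power-bounded if $\sup_{n\ge0}\|T^n\|<\infty$. The function $m_{\log}\colon(0,\pi]\to(0,\infty)$ is defined by $m_{\log}(\epsilon)=m(\epsilon)\log\left(1+\frac{m(\epsilon)}{\epsilon}\right)$. It is continuous, strictly decreasing and unbounded as $\epsilon\to0+$; $m_{\log}^{-1}$ is its inverse function, defined on $[m_{\log}(\pi),\infty)$, so that $m_{\log}^{-1}(cn)$ is defined for all sufficiently large $n$. *)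

(* Defs.v *)
From Stdlib Require Import Reals Lra.
From Coquelicot Require Import Coquelicot.

Open Scope R_scope.

(** ** Operators on a complex Banach space [X]

    [B(X)] is rendered by the predicate [is_linear] of Coquelicot, which is
    linearity together with boundedness. *)

(* [Rbar]-valued, so that an unbounded map has norm [p_infty] and not a junk
   real value. *)
Definition opnorm {X : NormedModule C_AbsRing} (A : X -> X) : Rbar :=
  Lub_Rbar (fun r => exists x : X, norm x <= 1 /\ r = norm (A x)).

Definition opow {X : Type} (T : X -> X) (n : nat) : X -> X := Nat.iter n T.

Definition power_bounded {X : NormedModule C_AbsRing} (T : X -> X) : Prop :=
  exists K : R, forall n : nat, Rbar_le (opnorm (opow T n)) K.

Definition shifted {X : NormedModule C_AbsRing} (lambda : C) (T : X -> X)
  (x : X) : X := minus (scal (lambda : C_AbsRing) x) (T x).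

Definition invertible {X : NormedModule C_AbsRing} (A : X -> X) : Prop :=
  exists S : X -> X,
    is_linear S /\ (forall x, S (A x) = x) /\ (forall x, A (S x) = x).

Definition spectrum {X : NormedModule C_AbsRing} (T : X -> X) (lambda : C)
  : Prop := ~ invertible (shifted lambda T).

(* [iota] selects the unique solution [x] of [lambda x - T x = y]; this is
   meaningful for [lambda] outside the spectrum of [T]. *)
Definition resolvent {X : CompleteNormedModule C_AbsRing} (lambda : C)
  (T : X -> X) (y : X) : X := iota (fun x : X => shifted lambda T x = y).

Definition cis (theta : R) : C := (cos theta, sin theta).

(** ** The function [m_log] and its inverse *)

Definition mlog (m : R -> R) (eps : R) : R := m eps * ln (1 + m eps / eps).

(* The unique [eps] in [(0, PI]] with [mlog m eps = y]; meaningful for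
   [y >= mlog m PI]. *)
Definition mlog_inv (m : R -> R) (y : R) : R :=
  iota (fun eps : R => (0 < eps <= PI) /\ mlog m eps = y).

(* Main.v *)
Require Import Defs.
From Stdlib Require Import Reals Lra.
From Coquelicot Require Import Coquelicot.
From Stdlib Require Import ZArith Lia Psatz Classical FunctionalExtensionality.

Open Scope R_scope.

(** Sampling the resolvent at the [P] nodes [lambda_s = exp (i h (s + 1/2))],
    [h = 2 PI / P], one has exactly
    [P T^n x = sum_s lambda_s^(n+1) R(lambda_s, T) (x + T^P x)], which replaces
    every contour integral by a finite sum. Split the frequencies by a cutoff
    [phi] of width [A eps] around [1].

    The low part of [T^n - T^(n+1)] is a convolution of the bounded orbit with a
    kernel of [l^1] norm [O(A eps)]. In the high part one sums by parts [k]
    times; a difference of resolvents gives one more resolvent factor, so the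
    result is bounded by [M prod_(1 <= i <= k) (beta + i M) / n^k], where
    [M = m eps] and [beta = O(k / (A eps))] is the cost of differentiating a
    cutoff that is a [k]-fold moving average. If [eps M >= 1/2], taking [A] large
    makes [beta] negligible against [k M], and [k = c n / M] yields
    [O(M exp (- c n / M)) = O(eps)] when [c n = mlog m eps].

    If [eps m eps < 1/2] for some [eps], or if [m] is bounded, then the resolvent
    is bounded on the whole circle and the same summation by parts without any
    cutoff gives exponential decay at the required rate. *)

(** * Finite sums and points of the unit circle *)

(** The order [k] grows with [n], so a constant lost in a single summation by parts is lost to the
    power [k] and would alter [c] in the exponent. Every such factor must therefore be arbitrarily
    close to 1. For the ratio of arc to chord this is free: [P] may be as large as one likes,
    because no final bound involves it. The cutoff is the real obstacle. It must bear [k]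
    differences at a cost proportional to [k] each, while the [l^1] norm of its kernel stays bounded
    independently of [k]. A fixed smooth bump cannot do this, since derivatives of order [(C k)^k]
    for all [k] would make it analytic. Hence the cutoff depends on [k]: each of the [k] averages
    absorbs one difference, and averaging never increases the [l^1] norm of the kernel. The lower
    bound on [eps * m eps] is the growth that a spectral point at 1 forces on the resolvent, which
    explains why its failure leads to the bounded case. *)

Fixpoint psum {G : AbelianMonoid} (f : nat -> G) (n : nat) : G :=
  match n with O => zero | S n => plus (psum f n) (f n) end.

Lemma psum_ext {G : AbelianMonoid} (f g : nat -> G) n :
  (forall i, (i < n)%nat -> f i = g i) -> psum f n = psum g n.
Proof.
induction n as [|n IH]; intros H; simpl; [easy|].
rewrite IH, H; auto with arith.
Qed.

Lemma psum_zero {G : AbelianMonoid} (f : nat -> G) n :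
  (forall i, (i < n)%nat -> f i = zero) -> psum f n = zero.
Proof.
induction n as [|n IH]; intros H; simpl; [easy|].
rewrite IH, H, plus_zero_l; auto with arith.
Qed.

Lemma psum_plus {G : AbelianMonoid} (f g : nat -> G) n :
  psum (fun i => plus (f i) (g i)) n = plus (psum f n) (psum g n).
Proof.
induction n as [|n IH]; simpl; [now rewrite plus_zero_l|].
rewrite IH, <- !plus_assoc; f_equal.
rewrite !plus_assoc; f_equal; apply plus_comm.
Qed.

Lemma psum_switch {G : AbelianMonoid} (f : nat -> nat -> G) n m :
  psum (fun i => psum (f i) m) n = psum (fun j => psum (fun i => f i j) n) m.
Proof.
induction n as [|n IH]; simpl.
- now rewrite psum_zero.
- rewrite IH, <- psum_plus; easy.
Qed.

Lemma psum_single {G : AbelianMonoid} (f : nat -> G) n k :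
  (k < n)%nat -> (forall i, (i < n)%nat -> i <> k -> f i = zero) ->
  psum f n = f k.
Proof.
induction n as [|n IH]; intros Hk H; simpl; [lia|].
destruct (Nat.eq_dec k n) as [->|Hn].
- rewrite psum_zero, plus_zero_l; [easy|].
  intros i Hi; apply H; lia.
- rewrite IH, (H n), plus_zero_r; [easy|lia|lia|lia|].
  intros i Hi; apply H; lia.
Qed.

Lemma psum_Sn {G : AbelianMonoid} (f : nat -> G) n :
  psum f (S n) = plus (f 0%nat) (psum (fun i => f (S i)) n).
Proof.
induction n as [|n IH].
- simpl; now rewrite plus_zero_l, plus_zero_r.
- change (psum f (S (S n))) with (plus (psum f (S n)) (f (S n))).
  rewrite IH, <- plus_assoc; easy.
Qed.

Lemma psum_shift {G : AbelianMonoid} (f : nat -> G) P u :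
  (forall s, f (s + P)%nat = f s) ->
  psum (fun s => f (s + u)%nat) P = psum f P.
Proof.
intros Hf; induction u as [|u IH].
- apply psum_ext; intros; f_equal; lia.
- rewrite <- IH.
  destruct P as [|P]; [easy|].
  rewrite (psum_Sn (fun s => f (s + u)%nat)); simpl.
  rewrite plus_comm; f_equal.
  + rewrite <- (Hf u); f_equal; lia.
  + apply psum_ext; intros; f_equal; lia.
Qed.

Lemma psum_scal {K : Ring} {V : ModuleSpace K} (a : K) (f : nat -> V) n :
  psum (fun i => scal a (f i)) n = scal a (psum f n).
Proof.
induction n as [|n IH]; simpl.
- now rewrite scal_zero_r.
- now rewrite IH, scal_distr_l.
Qed.

Lemma psum_scal_r {K : Ring} {V : ModuleSpace K} (a : nat -> K) (x : V) n :
  psum (fun i => scal (a i) x) n = scal (psum a n) x.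
Proof.
induction n as [|n IH]; simpl.
- now rewrite scal_zero_l.
- now rewrite IH, scal_distr_r.
Qed.

Lemma norm_psum {K : AbsRing} {V : NormedModule K} (f : nat -> V) n :
  norm (psum f n) <= psum (fun i => norm (f i)) n.
Proof.
induction n as [|n IH]; simpl.
- rewrite norm_zero; apply Rle_refl.
- eapply Rle_trans; [apply norm_triangle|].
  apply Rplus_le_compat; [easy|apply Rle_refl].
Qed.

Lemma psum_le (f g : nat -> R) n :
  (forall i, (i < n)%nat -> f i <= g i) -> psum f n <= psum g n.
Proof.
induction n as [|n IH]; intros H; simpl; [apply Rle_refl|].
apply Rplus_le_compat; auto with arith.
Qed.

Lemma psum_Rmult (a : R) (f : nat -> R) n :
  psum (fun i => a * f i) n = a * psum f n.
Proof. exact (psum_scal (K := R_Ring) (V := Ring_ModuleSpace R_Ring) a f n). Qed.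

Lemma psum_const (a : R) n : psum (fun _ => a) n = INR n * a.
Proof.
induction n as [|n IH]; [simpl; change (0 = 0 * a); ring|].
rewrite S_INR; simpl; rewrite IH; change (INR n * a + a = (INR n + 1) * a).
ring.
Qed.

Lemma norm_psum_le {K : AbsRing} {V : NormedModule K} (f : nat -> V) n B :
  (forall i, (i < n)%nat -> norm (f i) <= B) -> norm (psum f n) <= INR n * B.
Proof.
intros H; eapply Rle_trans; [apply norm_psum|].
rewrite <- psum_const; now apply psum_le.
Qed.

Lemma psum_Cmult (a : C) (f : nat -> C) n :
  psum (fun i => (a * f i)%C) n = (a * psum f n)%C.
Proof. exact (psum_scal (K := C_Ring) (V := Ring_ModuleSpace C_Ring) a f n). Qed.

Lemma psum_Cplus (f g : nat -> C) n :
  psum (fun i => (f i + g i)%C) n = (psum f n + psum g n)%C.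
Proof. exact (psum_plus (G := C_AbelianMonoid) f g n). Qed.

Lemma Cmod_psum (f : nat -> C) n :
  Cmod (psum f n) <= psum (fun i => Cmod (f i)) n.
Proof. exact (norm_psum (V := C_NormedModule) f n). Qed.

Lemma psum_RtoC (f : nat -> R) n :
  RtoC (psum f n) = psum (fun i => RtoC (f i)) n.
Proof.
induction n as [|n IH]; [easy|].
simpl; rewrite <- IH; exact (RtoC_plus _ _).
Qed.

Lemma psum_Cconj (f : nat -> C) n :
  Cconj (psum f n) = psum (fun i => Cconj (f i)) n.
Proof.
induction n as [|n IH]; simpl.
- unfold Cconj; simpl; apply injective_projections; simpl; [easy|apply Ropp_0].
- rewrite <- IH; apply Cplus_conj.
Qed.

(** * Chords of the unit circle and geometric sums of its points *)

Lemma cis_plus a b : cis (a + b) = (cis a * cis b)%C.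
Proof.
unfold cis; rewrite cos_plus, sin_plus.
apply injective_projections; simpl; ring.
Qed.

Lemma cis_0 : cis 0 = RtoC 1.
Proof. unfold cis; now rewrite cos_0, sin_0. Qed.

Lemma cis_conj a : Cconj (cis a) = cis (- a).
Proof. unfold cis, Cconj; simpl; now rewrite cos_neg, sin_neg. Qed.

Lemma Cmod_cis a : Cmod (cis a) = 1.
Proof.
unfold Cmod, cis; simpl.
replace (_ + _) with 1; [apply sqrt_1|].
generalize (sin2_cos2 a); unfold Rsqr; lra.
Qed.

Lemma cis_period a (k : Z) : cis (a + 2 * PI * IZR k) = cis a.
Proof.
assert (Hn : forall b (n : nat), cis (b + 2 * PI * INR n) = cis b).
{ intros b n; unfold cis.
  replace (b + 2 * PI * INR n) with (b + 2 * INR n * PI) by ring.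
  now rewrite cos_period, sin_period. }
destruct (ZArith_dec.Z_le_gt_dec 0 k) as [Hk|Hk].
- rewrite <- (Z2Nat.id k Hk), <- INR_IZR_INZ; apply Hn.
- rewrite <- (Hn (a + 2 * PI * IZR k) (Z.to_nat (- k))).
  rewrite INR_IZR_INZ, Z2Nat.id, opp_IZR by lia.
  f_equal; ring.
Qed.

Lemma Cmod_1_minus_cis x : Cmod (1 - cis x) = 2 * Rabs (sin (x / 2)).
Proof.
unfold Cmod, cis; simpl.
replace x with (2 * (x / 2)) at 1 2 3 4 by field.
rewrite cos_2a_sin, sin_2a.
set (s := sin (x / 2)); set (c := cos (x / 2)).
assert (Hsc : s * s + c * c = 1).
{ generalize (sin2_cos2 (x / 2)); unfold Rsqr, s, c; lra. }
rewrite <- (sqrt_Rsqr_abs s).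
replace 2 with (sqrt (2 * 2)) at 5 by (apply sqrt_square; lra).
rewrite <- sqrt_mult by (try apply Rle_0_sqr; lra).
f_equal; unfold Rsqr.
transitivity (4 * (s * s) * (s * s + c * c)); [ring|rewrite Hsc; ring].
Qed.

Lemma Cmod_1_minus_cis_le x : Cmod (1 - cis x) <= Rabs x.
Proof.
rewrite Cmod_1_minus_cis.
assert (H : Rabs (sin (x / 2)) <= Rabs (x / 2)).
{ generalize (x / 2); intros y.
  assert (Hp : forall z, 0 <= z -> Rabs (sin z) <= z).
  { intros z Hz.
    assert (H1 : sin z <= z).
    { destruct (Req_dec z 0) as [->|Hz0]; [rewrite sin_0; lra|].
      left; apply sin_lt_x; lra. }
    assert (H2 : - z <= sin z).
    { destruct (Rle_dec z 1) as [Hle|Hgt].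
      - generalize (sin_ge_0 z Hz); generalize PI2_1; unfold PI2; intros;
        assert (z <= PI) by lra; lra.
      - generalize (SIN_bound z); lra. }
    apply Rabs_le; lra. }
  destruct (Rle_dec 0 y) as [Hy|Hy].
  - rewrite (Rabs_pos_eq y) by easy; auto.
  - rewrite <- (Rabs_Ropp (sin y)), <- (Rabs_Ropp y), <- sin_neg.
    rewrite (Rabs_pos_eq (- y)) by lra; apply Hp; lra. }
unfold Rdiv in H at 2; rewrite Rabs_mult, (Rabs_pos_eq (/ 2)) in H by lra.
lra.
Qed.

(** The chord is asymptotic to the arc. A factor [rho] arbitrarily close to 1 matters, since it is
    later raised to the power [k]. *)
Lemma Cmod_1_minus_cis_ge rho : 1 < rho ->
  exists x0, 0 < x0 /\ forall x, 0 < x < x0 -> x <= rho * Cmod (1 - cis x).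
Proof.
intros Hr.
destruct (derivable_pt_lim_sin_0 (1 - / rho)) as [d Hd].
{ assert (/ rho < 1); [|lra].
  rewrite <- Rinv_1; apply Rinv_lt_contravar; lra. }
exists (2 * d); split; [generalize (cond_pos d); lra|].
intros x Hx.
assert (Hx2 : x / 2 <> 0) by lra.
specialize (Hd (x / 2) Hx2).
rewrite Rplus_0_l, sin_0, Rminus_0_r in Hd.
rewrite (Rabs_pos_eq (x / 2)) in Hd by lra.
assert (H : x / 2 < d) by lra; specialize (Hd H).
apply Rabs_def2 in Hd; destruct Hd as [_ Hd].
rewrite Cmod_1_minus_cis.
assert (H1 : / rho * (x / 2) < sin (x / 2)).
{ apply (Rmult_lt_reg_r (/ (x / 2))); [apply Rinv_0_lt_compat; lra|].
  unfold Rdiv in Hd at 1; rewrite Rmult_assoc, Rinv_r by lra; lra. }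
assert (H2 : rho * (/ rho * (x / 2)) < rho * sin (x / 2)).
{ apply Rmult_lt_compat_l; lra. }
rewrite <- Rmult_assoc, Rinv_r in H2 by lra.
generalize (Rle_abs (sin (x / 2))); nra.
Qed.

Lemma cis_neq_1 x : 0 < Rabs x < 2 * PI -> cis x <> RtoC 1.
Proof.
intros [H0 H1] He.
assert (H : Cmod (1 - cis x) = 0).
{ rewrite He; replace (1 - 1)%C with (RtoC 0) by ring; apply Cmod_0. }
rewrite Cmod_1_minus_cis in H.
assert (Hs : sin (x / 2) = 0).
{ destruct (Req_dec (sin (x / 2)) 0) as [Hz|Hz]; [easy|].
  generalize (Rabs_pos_lt _ Hz); lra. }
unfold Rabs in H0, H1; destruct (Rcase_abs x) as [Hx|Hx].
- assert (0 < sin (- (x / 2))) by (apply sin_gt_0; lra).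
  rewrite sin_neg in *; lra.
- assert (0 < sin (x / 2)) by (apply sin_gt_0; lra); lra.
Qed.

Lemma cis_sum_0 x P : cis x <> RtoC 1 -> cis (x * INR P) = RtoC 1 ->
  psum (fun e => cis (x * INR e)) P = RtoC 0.
Proof.
intros H1 HP.
assert (H : ((1 - cis x) * psum (fun e => cis (x * INR e)) P
             = 1 - cis (x * INR P))%C).
{ clear HP; induction P as [|P IH].
  - simpl; rewrite Rmult_0_r, cis_0; change (@zero C_AbelianMonoid) with (RtoC 0); ring.
  - change (psum (fun e => cis (x * INR e)) (S P)) with
      (psum (fun e => cis (x * INR e)) P + cis (x * INR P))%C.
    rewrite Cmult_plus_distr_l, IH, S_INR, Rmult_plus_distr_l, Rmult_1_r, cis_plus.
    ring. }
rewrite HP in H.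
assert (Hn : (1 - cis x)%C <> RtoC 0).
{ intros Hc; apply H1.
  replace (cis x) with (1 - (1 - cis x))%C by ring; rewrite Hc; ring. }
replace (1 - 1)%C with (RtoC 0) in H by ring.
destruct (Ceq_dec (psum (fun e => cis (x * INR e)) P) 0) as [Hz|Hz]; [easy|].
now destruct (Cmult_neq_0 _ _ Hn Hz).
Qed.

(** * Fourier analysis on [Z/P] *)

(* [ring] does not see through the canonical structures on [R] and [C]. *)
Ltac nring :=
  match goal with
  | |- @eq _ ?a ?b =>
      first [change (@eq R a b); ring | change (@eq C a b); ring]
  end.

Lemma cis_full_turn h P (d : Z) : Rabs h * INR P = 2 * PI ->
  cis (h * IZR d * INR P) = RtoC 1.
Proof.
intros Hh; rewrite <- cis_0.
unfold Rabs in Hh; destruct (Rcase_abs h).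
- rewrite <- (cis_period 0 (- d)); f_equal; rewrite opp_IZR, <- Hh; ring.
- rewrite <- (cis_period 0 d); f_equal; rewrite <- Hh; ring.
Qed.

Lemma cis_orthogonality h P (d : Z) : Rabs h * INR P = 2 * PI ->
  (0 < Z.abs d < Z.of_nat P)%Z ->
  psum (fun e => cis (h * IZR d * INR e)) P = RtoC 0.
Proof.
intros Hh Hd.
assert (HP : 0 < INR P) by (apply lt_0_INR; lia).
assert (Hh0 : 0 < Rabs h) by (generalize PI_RGT_0; nra).
apply cis_sum_0; [|now apply cis_full_turn].
apply cis_neq_1; rewrite Rabs_mult, <- abs_IZR, <- Hh, INR_IZR_INZ.
split.
- apply Rmult_lt_0_compat; [easy|apply IZR_lt; lia].
- apply Rmult_lt_compat_l; [easy|apply IZR_lt; lia].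
Qed.

(** After expanding the squares, orthogonality leaves the diagonal, because two indices below
    [n <= P] differ by less than [P]. Allowing [n < P] covers averaging weights, which live on few
    points; [Rabs h] allows the use with both [h] and [- h] in [fourier_l1_convolution]. *)
Lemma parseval h P n (a : nat -> C) : Rabs h * INR P = 2 * PI -> (n <= P)%nat ->
  psum (fun e => Cmod (psum (fun s => a s * cis (h * INR s * INR e))%C n) ^ 2) P
  = INR P * psum (fun s => Cmod (a s) ^ 2) n.
Proof.
intros Hh Hn.
assert (Hsq : forall z, RtoC (Cmod z ^ 2) = (z * Cconj z)%C).
{ intros z; now rewrite <- Cmod2_conj. }
apply RtoC_inj.
rewrite RtoC_mult, !psum_RtoC.
transitivity (psum (fun e => psum (fun s => psum (fun t =>
   (a s * Cconj (a t)) * cis (h * IZR (Z.of_nat s - Z.of_nat t) * INR e))%C n) n) P).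
{ apply psum_ext; intros e _.
  rewrite Hsq, psum_Cconj, Cmult_comm, <- psum_Cmult.
  apply psum_ext; intros s _.
  rewrite Cmult_comm, <- psum_Cmult.
  apply psum_ext; intros t _.
  rewrite Cmult_conj, cis_conj.
  rewrite minus_IZR, <- !INR_IZR_INZ.
  replace (h * (INR s - INR t) * INR e)
    with (h * INR s * INR e + - (h * INR t * INR e)) by ring.
  rewrite cis_plus; nring. }
rewrite psum_switch, <- psum_Cmult.
apply psum_ext; intros s Hs.
rewrite psum_switch, (psum_single _ _ s); [|easy|].
- rewrite Hsq, Z.sub_diag.
  rewrite <- (psum_ext (fun _ => RtoC (1 * 1) * (a s * Cconj (a s)))%C).
  + rewrite <- (psum_ext (fun _ => (a s * Cconj (a s)) * RtoC 1)%C).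
    * rewrite psum_Cmult, <- psum_RtoC, psum_const, Rmult_1_r; nring.
    * intros; rewrite Rmult_1_l; nring.
  + intros e _.
    replace (h * 0 * INR e) with 0 by ring; rewrite cis_0, Rmult_1_l; nring.
- intros t Ht Hts.
  rewrite psum_Cmult, cis_orthogonality; [|easy|lia].
  exact (Cmult_0_r _).
Qed.

(* Unnormalized: the factor [1/P] of the inverse transform is omitted. *)
Definition fourier_l1 (h : R) (P : nat) (g : nat -> C) : R :=
  psum (fun e => Cmod (psum (fun s => g s * cis (- (h * INR s * INR e)))%C P)) P.

Definition periodic {A : Type} (P : nat) (g : nat -> A) : Prop :=
  forall s, g (s + P)%nat = g s.

Lemma periodic_cis h P (j : nat) :
  Rabs h * INR P = 2 * PI -> periodic P (fun s => cis (- (h * INR s * INR j))).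
Proof.
intros Hh s.
replace (- (h * INR (s + P) * INR j))
  with (- (h * INR s * INR j) + h * IZR (- Z.of_nat j) * INR P).
- rewrite cis_plus, cis_full_turn by easy; nring.
- rewrite opp_IZR, <- INR_IZR_INZ, plus_INR; ring.
Qed.

Lemma fourier_l1_ext h P g g' : (forall s, (s < P)%nat -> g s = g' s) ->
  fourier_l1 h P g = fourier_l1 h P g'.
Proof.
intros H; apply psum_ext; intros e _; f_equal.
apply psum_ext; intros s Hs; now rewrite H.
Qed.

Lemma fourier_l1_ge_0 h P g : 0 <= fourier_l1 h P g.
Proof.
unfold fourier_l1.
replace 0 with (psum (fun _ => 0) P) by (rewrite psum_const; nring).
apply psum_le; intros; apply Cmod_ge_0.
Qed.

Lemma fourier_l1_scal h P c g :
  fourier_l1 h P (fun s => c * g s)%C = Cmod c * fourier_l1 h P g.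
Proof.
unfold fourier_l1; rewrite <- psum_Rmult; apply psum_ext; intros e _.
rewrite <- Cmod_mult, <- psum_Cmult; f_equal.
apply psum_ext; intros; nring.
Qed.

Lemma fourier_l1_psum h P (g : nat -> nat -> C) v :
  fourier_l1 h P (fun s => psum (fun u => g u s) v)
  <= psum (fun u => fourier_l1 h P (g u)) v.
Proof.
unfold fourier_l1; rewrite psum_switch; apply psum_le; intros e _.
eapply Rle_trans; [|apply Cmod_psum].
right; f_equal; rewrite <- psum_switch; apply psum_ext; intros s _.
rewrite Cmult_comm, <- psum_Cmult; apply psum_ext; intros; nring.
Qed.

Lemma fourier_l1_plus h P g g' :
  fourier_l1 h P (fun s => g s + g' s)%C <= fourier_l1 h P g + fourier_l1 h P g'.
Proof.
unfold fourier_l1.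
eapply Rle_trans; [|right; exact (psum_plus (G := R_AbelianMonoid) _ _ _)].
apply psum_le; intros e _.
eapply Rle_trans; [|apply Cmod_triangle].
right; f_equal; rewrite <- psum_Cplus; apply psum_ext; intros; nring.
Qed.

Lemma fourier_shift h P g u e : Rabs h * INR P = 2 * PI -> periodic P g ->
  psum (fun s => g (s + u)%nat * cis (- (h * INR s * INR e)))%C P
  = (cis (h * INR u * INR e) * psum (fun s => g s * cis (- (h * INR s * INR e))) P)%C.
Proof.
intros Hh Hg; rewrite <- psum_Cmult.
rewrite <- (psum_shift (fun s => cis (h * INR u * INR e) *
   (g s * cis (- (h * INR s * INR e))))%C P u).
- apply psum_ext; intros s _.
  replace (- (h * INR s * INR e))
    with (h * INR u * INR e + - (h * INR (s + u) * INR e))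
    by (rewrite plus_INR; ring).
  rewrite cis_plus; nring.
- intros s; rewrite (Hg s).
  now generalize (periodic_cis h P e Hh s); intros ->.
Qed.

Lemma fourier_l1_shift h P g u : Rabs h * INR P = 2 * PI -> periodic P g ->
  fourier_l1 h P (fun s => g (s + u)%nat) = fourier_l1 h P g.
Proof.
intros Hh Hg; apply psum_ext; intros e _.
rewrite fourier_shift, Cmod_mult, Cmod_cis by easy; nring.
Qed.

(** A character only translates the frequencies over a full period. *)
Lemma fourier_l1_modulate h P g w : Rabs h * INR P = 2 * PI ->
  fourier_l1 h P (fun s => cis (- (h * INR s * INR w)) * g s)%C = fourier_l1 h P g.
Proof.
intros Hh; unfold fourier_l1.
rewrite <- (psum_shift (fun e => Cmod (psum (fun s => g s *
  cis (- (h * INR s * INR e)))%C P)) P w).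
- apply psum_ext; intros e _; f_equal; apply psum_ext; intros s _.
  replace (- (h * INR s * INR (e + w)))
    with (- (h * INR s * INR w) + - (h * INR s * INR e))
    by (rewrite plus_INR; ring).
  rewrite cis_plus; nring.
- intros e; f_equal; apply psum_ext; intros s _; f_equal.
  generalize (periodic_cis h P s Hh e); intros H.
  replace (h * INR s * INR (e + P)) with (h * INR (e + P) * INR s) by ring.
  rewrite H; f_equal; nring.
Qed.

(** The transform of a correlation is a product of two transforms. The weighted inequality
    [2 x y <= al x^2 + y^2 / al] replaces Cauchy-Schwarz and avoids square roots; Parseval then
    evaluates each factor. The weight [al] is left free so that each use can balance the two
    terms. *)
Lemma fourier_l1_convolution h P W al (a g : nat -> C) :
  Rabs h * INR P = 2 * PI -> periodic P g -> (W <= P)%nat -> 0 < al ->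
  fourier_l1 h P (fun s => psum (fun u => a u * g (s + u)%nat)%C W)
  <= INR P * ((al * psum (fun u => Cmod (a u) ^ 2) W
               + / al * psum (fun s => Cmod (g s) ^ 2) P) / 2).
Proof.
intros Hh Hg HW Hal.
assert (Hh' : Rabs (- h) * INR P = 2 * PI) by now rewrite Rabs_Ropp.
eapply Rle_trans; [apply (psum_le _ (fun e =>
  al / 2 * Cmod (psum (fun u => a u * cis (h * INR u * INR e))%C W) ^ 2
  + / al / 2 * Cmod (psum (fun s => g s * cis (- h * INR s * INR e))%C P) ^ 2))|].
- intros e _.
  replace (psum (fun s => psum (fun u => a u * g (s + u)%nat) W
                          * cis (- (h * INR s * INR e)))%C P)
    with (psum (fun u => a u * cis (h * INR u * INR e))%C W
          * psum (fun s => g s * cis (- h * INR s * INR e))%C P)%C.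
  + rewrite Cmod_mult.
    set (x := Cmod (psum _ W)); set (y := Cmod (psum _ P)).
    assert (Hi : 0 < / al) by now apply Rinv_0_lt_compat.
    assert (Hii : al * / al = 1) by (apply Rinv_r; lra).
    assert (H := pow2_ge_0 (al * x - y)).
    apply (Rmult_le_reg_l (2 * al)); [lra|].
    replace (2 * al * (al / 2 * x ^ 2 + / al / 2 * y ^ 2))
      with (al ^ 2 * x ^ 2 + al * / al * y ^ 2) by (field; lra).
    rewrite Hii; nra.
  + transitivity (psum (fun u => psum (fun s =>
      a u * (g (s + u)%nat * cis (- (h * INR s * INR e))))%C P) W).
    * rewrite Cmult_comm, <- psum_Cmult; apply psum_ext; intros u _.
      rewrite psum_Cmult, fourier_shift by easy.
      rewrite (psum_ext (fun s => g s * cis (- (h * INR s * INR e)))%C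
        (fun s => g s * cis (- h * INR s * INR e))%C); [nring|].
      intros; f_equal; f_equal; nring.
    * rewrite psum_switch; apply psum_ext; intros s _.
      rewrite Cmult_comm, <- psum_Cmult; apply psum_ext; intros; nring.
- rewrite (psum_plus (G := R_AbelianMonoid)), !psum_Rmult.
  rewrite parseval, parseval by (easy || apply le_n).
  right; change (@plus R_AbelianMonoid) with Rplus; field; lra.
Qed.

(** * The cutoff *)

(* The half-integer offset keeps the nodes away from [1]. *)
Definition node (h : R) (s : nat) : C := cis (h * (INR s + / 2)).

Definition grad (f : nat -> C) (s : nat) : C := (f s - f (S s))%C.

Definition avg (v : nat) (f : nat -> C) (s : nat) : C :=
  (/ RtoC (INR v) * psum (fun u => f (s + u)%nat) v)%C.

Lemma node_add h s u : node h (s + u) = (node h s * cis (h * INR u))%C.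
Proof.
unfold node; rewrite <- cis_plus, plus_INR; f_equal; ring.
Qed.

Lemma periodic_node h P : Rabs h * INR P = 2 * PI -> periodic P (node h).
Proof.
intros Hh s; rewrite node_add.
replace (h * INR P) with (h * IZR 1 * INR P) by ring.
rewrite cis_full_turn by easy; ring.
Qed.

Lemma Cmod_node h s : Cmod (node h s) = 1.
Proof. apply Cmod_cis. Qed.

Lemma Cinv_INR_mult n z : (1 <= n)%nat ->
  (/ RtoC (INR n) * (RtoC (INR n) * z))%C = z.
Proof.
intros Hn; rewrite Cmult_assoc, Cinv_l; [ring|].
intros H; apply RtoC_inj in H; revert H; apply not_0_INR; lia.
Qed.

Lemma Cmod_inv_INR n : (1 <= n)%nat -> Cmod (/ RtoC (INR n)) = / INR n.
Proof.
intros Hn.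
assert (0 < INR n) by (apply lt_0_INR; lia).
rewrite Cmod_inv.
- rewrite Cmod_R, Rabs_pos_eq by lra; easy.
- intros He; apply RtoC_inj in He; lra.
Qed.

Lemma avg_const v f s c : (1 <= v)%nat ->
  (forall u, (u < v)%nat -> f (s + u)%nat = c) -> avg v f s = c.
Proof.
intros Hv H; unfold avg.
rewrite (psum_ext _ (fun _ => c * RtoC 1)%C).
- rewrite psum_Cmult, <- psum_RtoC, psum_const, Rmult_1_r, (Cmult_comm c).
  now apply Cinv_INR_mult.
- intros u Hu; rewrite H by easy; nring.
Qed.

Lemma avg_periodic P v f : periodic P f -> periodic P (avg v f).
Proof.
intros Hf s; unfold avg; f_equal; apply psum_ext; intros u _.
rewrite <- (Hf (s + u)%nat); f_equal; lia.
Qed.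

Lemma Cmod_avg_le v f B s : (1 <= v)%nat -> (forall t, Cmod (f t) <= B) ->
  Cmod (avg v f s) <= B.
Proof.
intros Hv H; unfold avg.
assert (0 < INR v) by (apply lt_0_INR; lia).
rewrite Cmod_mult, Cmod_inv_INR by easy.
apply (Rmult_le_reg_l (INR v)); [easy|].
rewrite <- Rmult_assoc, Rinv_r, Rmult_1_l by lra.
apply (norm_psum_le (V := C_NormedModule)); intros; apply H.
Qed.

(** A difference of a moving average telescopes to its two ends. Each average thus absorbs one
    difference, at the price of a factor [2 / v]. *)
Lemma grad_avg v f l s :
  Nat.iter (S l) grad (avg v f) s
  = (/ RtoC (INR v) * (Nat.iter l grad f s - Nat.iter l grad f (s + v)%nat))%C.
Proof.
revert s; induction l as [|l IH]; intros s.
- simpl; unfold grad, avg.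
  rewrite (psum_ext (fun u => f (S s + u)%nat) (fun u => f (s + S u)%nat)).
  2: { intros; f_equal; lia. }
  generalize (psum_Sn (fun u => f (s + u)%nat) v); simpl.
  rewrite Nat.add_0_r; intros H.
  change (psum (fun u => f (s + u)%nat) v + f (s + v)%nat
          = f s + psum (fun u => f (s + S u)%nat) v)%C in H.
  transitivity (/ RtoC (INR v) * (psum (fun u => f (s + u)%nat) v + f (s + v)%nat
    - f (s + v)%nat - psum (fun u => f (s + S u)%nat) v))%C; [ring|].
  rewrite H; ring.
- change (Nat.iter (S (S l)) grad (avg v f) s)
    with (Nat.iter (S l) grad (avg v f) s - Nat.iter (S l) grad (avg v f) (S s))%C.
  rewrite !IH; simpl; unfold grad; ring.
Qed.

Lemma Cmod_grad_avg_le v f B k : (1 <= v)%nat -> (forall s, Cmod (f s) <= B) ->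
  forall l s, (l <= k)%nat ->
  Cmod (Nat.iter l grad (Nat.iter k (avg v) f) s) <= B * (2 / INR v) ^ l.
Proof.
intros Hv HB.
assert (Hv0 : 0 < INR v) by (apply lt_0_INR; lia).
induction k as [|k IH]; intros l s Hl.
- replace l with 0%nat by lia; simpl; rewrite Rmult_1_r; apply HB.
- destruct l as [|l].
  + simpl; rewrite Rmult_1_r; apply Cmod_avg_le; [easy|].
    intros t; rewrite <- (Rmult_1_r B); apply (IH 0%nat); lia.
  + change (Nat.iter (S k) (avg v) f) with (avg v (Nat.iter k (avg v) f)).
    rewrite grad_avg, Cmod_mult, Cmod_inv_INR by easy.
    eapply Rle_trans.
    { apply Rmult_le_compat_l; [left; now apply Rinv_0_lt_compat|].
      eapply Rle_trans; [apply Cmod_triangle|].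
      rewrite Cmod_opp; apply Rplus_le_compat; apply IH; lia. }
    right; simpl; field; lra.
Qed.

Lemma iter_avg_const v f c k s : (1 <= v)%nat ->
  (forall t, (t <= k * v)%nat -> f (s + t)%nat = c) ->
  Nat.iter k (avg v) f s = c.
Proof.
intros Hv; revert s; induction k as [|k IH]; intros s H.
- rewrite <- (Nat.add_0_r s) at 1; apply H; lia.
- apply avg_const; [easy|]; intros u Hu; apply IH.
  intros t Ht; rewrite <- Nat.add_assoc; apply H; simpl; lia.
Qed.

(** An average is a convex combination of translates, and translates have the same norm. This makes
    the bounds on the cutoff uniform in the number of averages. *)
Lemma fourier_l1_avg h P v f : (1 <= v)%nat -> Rabs h * INR P = 2 * PI ->
  periodic P f -> fourier_l1 h P (avg v f) <= fourier_l1 h P f.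
Proof.
intros Hv Hh Hf; unfold avg.
rewrite fourier_l1_scal, Cmod_inv_INR by easy.
assert (0 < INR v) by (apply lt_0_INR; lia).
apply (Rmult_le_reg_l (INR v)); [easy|].
rewrite <- Rmult_assoc, Rinv_r, Rmult_1_l by lra.
eapply Rle_trans; [apply (fourier_l1_psum h P (fun u s => f (s + u)%nat))|].
rewrite <- psum_const; right; apply psum_ext; intros u _.
now apply fourier_l1_shift.
Qed.

(** Multiplication by [1 - lambda_s] is the effect, on the frequency side, of passing from [T^n] to
    [T^n - T^(n+1)]. *)
Definition damped (h : R) (f : nat -> C) (s : nat) : C := ((1 - node h s) * f s)%C.

Lemma damped_periodic h P f : Rabs h * INR P = 2 * PI -> periodic P f ->
  periodic P (damped h f).
Proof.
intros Hh Hf s; unfold damped; now rewrite Hf, (periodic_node h P Hh s).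
Qed.

Lemma damped_shift h f s u :
  ((1 - node h s) * f (s + u)%nat
   = damped h f (s + u)
     + (1 - cis (- (h * INR u))) * (node h (s + u) * f (s + u)%nat))%C.
Proof.
unfold damped; rewrite node_add.
assert (H : (cis (h * INR u) * cis (- (h * INR u)) = 1)%C).
{ rewrite <- cis_plus, Rplus_opp_r; apply cis_0. }
transitivity (f (s + u)%nat - node h s * (cis (h * INR u) * cis (- (h * INR u)))
  * f (s + u)%nat)%C; [rewrite H|]; ring.
Qed.

(** Up to the constant phase [cis (h / 2)], [node h] is the character that [fourier_l1_modulate]
    indexes by [- 1], written [P - 1] to stay in [nat]. *)
Lemma fourier_l1_node h P f : (1 <= P)%nat -> Rabs h * INR P = 2 * PI ->
  fourier_l1 h P (fun s => node h s * f s)%C = fourier_l1 h P f.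
Proof.
intros HP Hh.
rewrite <- (fourier_l1_modulate h P f (P - 1)) by easy.
rewrite <- (Rmult_1_l (fourier_l1 h P (fun s => cis _ * f s)%C)).
rewrite <- (Cmod_cis (h / 2)), <- fourier_l1_scal.
apply fourier_l1_ext; intros s _.
rewrite Cmult_assoc, <- cis_plus; f_equal; unfold node.
rewrite <- (Cmult_1_r (cis (h / 2 + _))).
rewrite <- (cis_full_turn h P (Z.of_nat s) Hh), <- cis_plus; f_equal.
rewrite minus_INR, <- INR_IZR_INZ by lia; simpl; field.
Qed.

(** Damping almost commutes with averaging: by [damped_shift] the commutator with a translation by
    [u] has size [h * u]. So [k] averages of length [v] add only a multiple of [h * k * v], the
    angular width of the window. *)
Lemma fourier_l1_damped_avg h P v f : (1 <= v)%nat -> (1 <= P)%nat -> 0 < h ->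
  h * INR P = 2 * PI -> periodic P f ->
  fourier_l1 h P (damped h (avg v f))
  <= fourier_l1 h P (damped h f) + h * INR v * fourier_l1 h P f.
Proof.
intros Hv HP Hh0 Hh Hf.
assert (Hh' : Rabs h * INR P = 2 * PI) by (rewrite Rabs_pos_eq; lra).
assert (Hv0 : 0 < INR v) by (apply lt_0_INR; lia).
rewrite (fourier_l1_ext h P _ (fun s => / RtoC (INR v) *
  psum (fun u => (1 - node h s) * f (s + u)%nat) v)%C).
2: { intros s _; rewrite psum_Cmult; unfold damped, avg; ring. }
rewrite fourier_l1_scal, Cmod_inv_INR by easy.
apply (Rmult_le_reg_l (INR v)); [easy|].
rewrite <- Rmult_assoc, Rinv_r, Rmult_1_l by lra.
eapply Rle_trans; [apply (fourier_l1_psum h P (fun u s => (1 - node h s) * f (s + u)%nat)%C)|].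
rewrite <- psum_const; apply psum_le; intros u Hu.
rewrite (fourier_l1_ext h P _ (fun s => damped h f (s + u) +
  (1 - cis (- (h * INR u))) * (node h (s + u) * f (s + u)%nat))%C)
  by (intros; apply damped_shift).
eapply Rle_trans; [apply fourier_l1_plus|].
rewrite fourier_l1_scal.
rewrite (fourier_l1_shift h P (damped h f)) by (easy || now apply damped_periodic).
rewrite (fourier_l1_shift h P (fun s => node h s * f s)%C), fourier_l1_node;
  try easy.
2: { intros s; now rewrite Hf, (periodic_node h P Hh' s). }
apply Rplus_le_compat_l, Rmult_le_compat_r; [apply fourier_l1_ge_0|].
eapply Rle_trans; [apply Cmod_1_minus_cis_le|].
assert (Hu' : INR u <= INR v) by (apply le_INR; lia).
generalize (pos_INR u); intros Hu0.
rewrite Rabs_Ropp, Rabs_pos_eq; nra.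
Qed.

(** The indicator of the arc [- W <= s < 3 * W] modulo [P]. It is off-centre because [avg] looks
    forward: one average over [W] points and [k] averages over [v = W / k] points reach at most
    [2 * W] ahead, which leaves the value 1 on [- W <= s <= W]. *)
Definition window (P W : nat) (s : nat) : C :=
  if Nat.ltb ((s + W) mod P) (4 * W) then RtoC 1 else RtoC 0.

Lemma window_periodic P W : periodic P (window P W).
Proof.
intros s; unfold window.
replace (s + P + W)%nat with (s + W + 1 * P)%nat by lia.
now rewrite Nat.Div0.mod_add.
Qed.

Lemma Cmod_window_le P W s : Cmod (window P W s) <= 1.
Proof.
unfold window; destruct (Nat.ltb _ _); [rewrite Cmod_1|rewrite Cmod_0]; lra.
Qed.

Lemma psum_indicator n m :
  psum (fun s => if Nat.ltb s m then 1 else 0) n = INR (Nat.min n m).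
Proof.
induction n as [|n IH]; [easy|].
transitivity (INR (Nat.min n m) + (if Nat.ltb n m then 1 else 0)).
{ now rewrite <- IH. }
destruct (Nat.ltb_spec n m).
- rewrite !Nat.min_l, S_INR by lia; easy.
- rewrite !Nat.min_r by lia; apply Rplus_0_r.
Qed.

Lemma window_sum P W : (4 * W <= P)%nat ->
  psum (fun s => Cmod (window P W s) ^ 2) P <= 4 * INR W.
Proof.
intros HW.
set (f := fun s => if Nat.ltb (s mod P) (4 * W) then 1 else 0).
rewrite (psum_ext _ (fun s => f (s + W)%nat)).
2: { intros s _; unfold f, window; destruct (Nat.ltb _ _);
     rewrite ?Cmod_1, ?Cmod_0; nring. }
rewrite psum_shift.
2: { intros s; unfold f; replace (s + P)%nat with (s + 1 * P)%nat by lia.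
     now rewrite Nat.Div0.mod_add. }
rewrite (psum_ext _ (fun s => if Nat.ltb s (4 * W) then 1 else 0)).
2: { intros s Hs; unfold f; now rewrite Nat.mod_small. }
rewrite psum_indicator, Nat.min_r, mult_INR by easy; simpl; lra.
Qed.

(** Averaging the indicator over [W] points gives a trapezoid, a convolution of two indicators,
    whose kernel is of de la Vallee Poussin type. The energies are [1 / W] and at most [4 * W], and
    the weight [2 * INR W] balances them. *)
Lemma fourier_l1_window h P W : (1 <= W)%nat -> (4 * W <= P)%nat ->
  Rabs h * INR P = 2 * PI ->
  fourier_l1 h P (avg W (window P W)) <= INR P * 2.
Proof.
intros HW HP Hh.
assert (HW0 : 0 < INR W) by (apply lt_0_INR; lia).
rewrite (fourier_l1_ext h P _ (fun s =>
  psum (fun u => / RtoC (INR W) * window P W (s + u)%nat)%C W)).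
2: { intros s _; unfold avg; now rewrite psum_Cmult. }
eapply Rle_trans; [apply (fourier_l1_convolution h P W (2 * INR W)
  (fun _ => / RtoC (INR W))%C (window P W));
  [easy|apply window_periodic|lia|lra]|].
apply Rmult_le_compat_l; [apply pos_INR|].
rewrite Cmod_inv_INR, psum_const by easy.
generalize (window_sum P W HP); set (S := psum _ P); intros HS.
assert (HS' : / (2 * INR W) * S <= / (2 * INR W) * (4 * INR W)).
{ apply Rmult_le_compat_l; [left; apply Rinv_0_lt_compat; lra|easy]. }
replace (/ (2 * INR W) * (4 * INR W)) with 2 in HS' by (field; lra).
replace (2 * INR W * (INR W * (/ INR W) ^ 2)) with 2 by (field; lra).
lra.
Qed.

Lemma damped_window_le h P W s : (1 <= W)%nat -> (4 * W <= P)%nat -> 0 < h ->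
  h * INR P = 2 * PI ->
  Cmod (damped h (window P W) s) <= 4 * INR W * h * Cmod (window P W s).
Proof.
intros HW HP Hh0 Hh; unfold damped; rewrite Cmod_mult.
assert (HW1 : 1 <= INR W) by (apply (le_INR 1); lia).
unfold window; destruct (Nat.ltb_spec ((s + W) mod P) (4 * W)) as [Hr|Hr].
2: { rewrite Cmod_0; lra. }
apply Rmult_le_compat_r; [apply Cmod_ge_0|].
assert (Hd : (s + W = P * ((s + W) / P) + (s + W) mod P)%nat) by (apply Nat.div_mod; lia).
revert Hr Hd; generalize ((s + W) mod P)%nat ((s + W) / P)%nat; intros r q Hr Hd.
apply (f_equal INR) in Hd; rewrite !plus_INR, mult_INR in Hd.
apply le_INR in Hr; rewrite S_INR, mult_INR in Hr; simpl in Hr.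
unfold node; replace (h * (INR s + / 2)) with
  (h * (INR r - INR W + / 2) + h * INR P * INR q).
2: { replace (INR s) with (INR P * INR q + INR r - INR W) by lra; ring. }
rewrite Hh, (INR_IZR_INZ q), cis_period.
eapply Rle_trans; [apply Cmod_1_minus_cis_le|].
rewrite Rabs_mult, Rabs_pos_eq by lra; rewrite (Rmult_comm _ h).
apply Rmult_le_compat_l; [lra|].
generalize (pos_INR r); intros; apply Rabs_le; lra.
Qed.

Lemma fourier_l1_damped_window h P W : (1 <= W)%nat -> (4 * W <= P)%nat -> 0 < h ->
  h * INR P = 2 * PI ->
  fourier_l1 h P (damped h (avg W (window P W))) <= INR P * (10 * (INR W * h)).
Proof.
intros HW HP Hh0 Hh.
assert (HW0 : 0 < INR W) by (apply lt_0_INR; lia).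
assert (Hh' : Rabs h * INR P = 2 * PI) by (rewrite Rabs_pos_eq; lra).
assert (Hi : Cmod (/ RtoC (INR W)) = / INR W) by now apply Cmod_inv_INR.
set (w := window P W).
assert (Hw : periodic P w) by apply window_periodic.
assert (Hws : psum (fun s => Cmod (w s) ^ 2) P <= 4 * INR W) by now apply window_sum.
rewrite (fourier_l1_ext h P _ (fun s =>
  psum (fun u => / RtoC (INR W) * damped h w (s + u)%nat)%C W +
  psum (fun u => (/ RtoC (INR W) * (1 - cis (- (h * INR u))))
          * (fun t => node h t * w t)%C (s + u)%nat)%C W)%C).
2: { intros s _; unfold damped at 1, avg.
     rewrite Cmult_assoc, (Cmult_comm (1 - _)), <- Cmult_assoc, <- psum_Cmult.
     rewrite <- psum_Cplus, <- psum_Cmult; apply psum_ext; intros u _.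
     fold w; rewrite damped_shift; nring. }
eapply Rle_trans; [apply fourier_l1_plus|].
replace (INR P * (10 * (INR W * h)))
  with (INR P * (8 * (INR W * h)) + INR P * (2 * (INR W * h))) by ring.
apply Rplus_le_compat.
(* The energies are [1 / W] and at most [(4 W h)^2 * 4 W]; this weight turns both into [8 W h]. *)
- eapply Rle_trans; [apply (fourier_l1_convolution h P W (8 * (INR W * INR W * h))
    (fun _ => / RtoC (INR W))%C (damped h w));
    [easy|now apply damped_periodic|lia|]|].
  { apply Rmult_lt_0_compat; [lra|]; apply Rmult_lt_0_compat; [nra|easy]. }
  apply Rmult_le_compat_l; [apply pos_INR|].
  rewrite Hi, psum_const.
  assert (HS : psum (fun s => Cmod (damped h w s) ^ 2) P
               <= (4 * INR W * h) ^ 2 * (4 * INR W)).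
  { apply Rle_trans with ((4 * INR W * h) ^ 2 * psum (fun s => Cmod (w s) ^ 2) P).
    - rewrite <- psum_Rmult; apply psum_le; intros s _.
      rewrite <- Rpow_mult_distr; apply pow_incr.
      split; [apply Cmod_ge_0|now apply damped_window_le].
    - apply Rmult_le_compat_l; [apply pow2_ge_0|easy]. }
  revert HS; set (S := psum _ P); intros HS.
  assert (HS' : / (8 * (INR W * INR W * h)) * S
    <= / (8 * (INR W * INR W * h)) * ((4 * INR W * h) ^ 2 * (4 * INR W))).
  { apply Rmult_le_compat_l; [left; apply Rinv_0_lt_compat|easy].
    apply Rmult_lt_0_compat; [lra|]; apply Rmult_lt_0_compat; [nra|easy]. }
  replace (/ (8 * (INR W * INR W * h)) * ((4 * INR W * h) ^ 2 * (4 * INR W)))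
    with (8 * (INR W * h)) in HS' by (field; lra).
  replace (8 * (INR W * INR W * h) * (INR W * (/ INR W) ^ 2))
    with (8 * (INR W * h)) by (field; lra).
  lra.
(* The commutator weights are at most [h] each, so their energy is at most [W h^2], against [4 W]
   for the window; the weight [2 / h] turns both into [2 W h]. *)
- eapply Rle_trans; [apply (fourier_l1_convolution h P W (2 / h)
    (fun u => / RtoC (INR W) * (1 - cis (- (h * INR u))))%C
    (fun t => node h t * w t)%C); [easy| |lia|]|].
  { intros s; now rewrite Hw, (periodic_node h P Hh' s). }
  { apply Rdiv_lt_0_compat; lra. }
  apply Rmult_le_compat_l; [apply pos_INR|].
  assert (H1 : psum (fun u => Cmod (/ RtoC (INR W) * (1 - cis (- (h * INR u)))) ^ 2) W
               <= INR W * h ^ 2).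
  { rewrite <- psum_const; apply psum_le; intros u Hu.
    apply pow_incr; split; [apply Cmod_ge_0|].
    rewrite Cmod_mult, Hi.
    apply (Rmult_le_reg_l (INR W)); [easy|].
    rewrite <- Rmult_assoc, Rinv_r, Rmult_1_l by lra.
    eapply Rle_trans; [apply Cmod_1_minus_cis_le|].
    assert (Hu' : INR u <= INR W) by (apply le_INR; lia).
    generalize (pos_INR u); intros Hu0.
    rewrite Rabs_Ropp, Rabs_pos_eq; nra. }
  assert (H2 : psum (fun s => Cmod (node h s * w s) ^ 2) P <= 4 * INR W).
  { eapply Rle_trans; [|exact Hws]; right; apply psum_ext; intros s _.
    now rewrite Cmod_mult, Cmod_node, Rmult_1_l. }
  revert H1 H2; set (S1 := psum _ W); set (S2 := psum _ P); intros H1 H2.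
  assert (H1' : 2 / h * S1 <= 2 / h * (INR W * h ^ 2)).
  { apply Rmult_le_compat_l; [left; apply Rdiv_lt_0_compat; lra|easy]. }
  assert (H2' : / (2 / h) * S2 <= / (2 / h) * (4 * INR W)).
  { apply Rmult_le_compat_l; [left; apply Rinv_0_lt_compat, Rdiv_lt_0_compat; lra|easy]. }
  replace (2 / h * (INR W * h ^ 2)) with (2 * (INR W * h)) in H1' by (field; lra).
  replace (/ (2 / h) * (4 * INR W)) with (2 * (INR W * h)) in H2' by (field; lra).
  lra.
Qed.

(** A discrete form of the cutoffs of Ehrenpreis: with [W = k * v], each of the first [k]
    differences costs [2 / v = 2 * k / W], linear in [k]. The averaged window serves as the starting
    point because its kernel already has a bounded [l^1] norm. *)
Lemma smooth_cutoff h P k v : (1 <= k)%nat -> (1 <= v)%nat ->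
  (4 * (k * v) <= P)%nat -> 0 < h -> h * INR P = 2 * PI ->
  exists phi : nat -> C,
    periodic P phi /\
    (forall l s, (l <= k)%nat -> Cmod (Nat.iter l grad phi s) <= (2 / INR v) ^ l) /\
    (forall s q r, (s + k * v = P * q + r)%nat -> (r <= 2 * (k * v))%nat ->
       phi s = RtoC 1) /\
    fourier_l1 h P (damped h phi) <= INR P * (12 * (INR (k * v) * h)).
Proof.
intros Hk Hv HP Hh0 Hh.
assert (Hh' : Rabs h * INR P = 2 * PI) by (rewrite Rabs_pos_eq; lra).
set (W := (k * v)%nat) in *.
assert (HW : (1 <= W)%nat) by (unfold W; nia).
set (g := avg W (window P W)).
assert (Hg : forall j, periodic P (Nat.iter j (avg v) g)).
{ induction j as [|j IH]; apply avg_periodic; [apply window_periodic|exact IH]. }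
exists (Nat.iter k (avg v) g); split; [apply Hg|split; [|split]].
- intros l s Hl; rewrite <- (Rmult_1_l (_ ^ l)).
  apply Cmod_grad_avg_le; [easy| |easy].
  intros t; apply Cmod_avg_le; [easy|intros; apply Cmod_window_le].
- intros s q r Hs Hr.
  apply iter_avg_const; [easy|]; intros t Ht.
  apply avg_const; [easy|]; intros u Hu.
  unfold window.
  replace (s + t + u + W)%nat with (r + t + u + q * P)%nat by lia.
  rewrite Nat.Div0.mod_add, Nat.mod_small by (fold W in Ht; lia).
  destruct (Nat.ltb_spec (r + t + u) (4 * W)); [easy|fold W in Ht; lia].
- assert (Hl1 : forall j, fourier_l1 h P (Nat.iter j (avg v) g) <= INR P * 2).
  { induction j as [|j IH]; [now apply fourier_l1_window|].
    eapply Rle_trans; [|exact IH].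
    apply fourier_l1_avg; [easy|easy|apply Hg]. }
  assert (Hv0 : 0 < INR v) by (apply lt_0_INR; lia).
  assert (Hj : forall j, fourier_l1 h P (damped h (Nat.iter j (avg v) g))
    <= INR P * (10 * (INR W * h)) + INR j * (h * INR v * (INR P * 2))).
  { induction j as [|j IH].
    - simpl INR; rewrite Rmult_0_l, Rplus_0_r; now apply fourier_l1_damped_window.
    - rewrite S_INR.
      change (Nat.iter (S j) (avg v) g) with (avg v (Nat.iter j (avg v) g)).
      eapply Rle_trans; [apply fourier_l1_damped_avg; solve [easy|lia|apply Hg]|].
      assert (h * INR v * fourier_l1 h P (Nat.iter j (avg v) g)
              <= h * INR v * (INR P * 2)).
      { apply Rmult_le_compat_l; [nra|apply Hl1]. }
      lra. }
  eapply Rle_trans; [apply Hj|].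
  (* The constant 12 is 10 from the trapezoid plus 2 from the [k] further averages. *)
  right; unfold W; rewrite mult_INR; ring.
Qed.

(** * Summation by parts against resolvents *)

(** A relation instead of [resolvent], so that the summation by parts rests on algebra alone and
    never unfolds a choice by [iota]. *)
Definition is_resolvent {X : NormedModule C_AbsRing} (T : X -> X) (z : C)
  (Rz : X -> X) : Prop :=
  (forall x, shifted z T (Rz x) = x) /\ (forall x, Rz (shifted z T x) = x).

(* Unfolding [minus] exposes the raw canonical structure and blocks rewriting. *)
Lemma minusE {G : AbelianGroup} (x y : G) : minus x y = plus x (opp y).
Proof. easy. Qed.

Lemma minus_minus_l {G : AbelianGroup} (a b c : G) :
  minus (minus a c) (minus b c) = minus a b.
Proof.
rewrite !minusE, opp_plus, opp_opp, <- plus_assoc; f_equal.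
rewrite (plus_comm (opp b) c), plus_assoc.
exact (eq_trans (f_equal (fun t => plus t (opp b)) (plus_opp_l c)) (plus_zero_l _)).
Qed.

Lemma linear_minus {X : NormedModule C_AbsRing} (T : X -> X) x y :
  is_linear T -> T (minus x y) = minus (T x) (T y).
Proof.
intros HT; rewrite !minusE, (linear_plus T HT); f_equal.
transitivity (T (scal (opp one) y)).
- f_equal; symmetry; apply (scal_opp_one y).
- rewrite (linear_scal T HT); apply (scal_opp_one (T y)).
Qed.

Lemma shifted_comm {X : NormedModule C_AbsRing} (T : X -> X) (z w : C) x :
  is_linear T ->
  shifted z T (shifted w T x) = shifted w T (shifted z T x).
Proof.
intros HT; unfold shifted.
assert (Hm : forall a b, T (minus a b) = minus (T a) (T b))
  by (intros; now apply linear_minus).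
rewrite !Hm, !(linear_scal T HT), !scal_minus_distr_l, !scal_assoc.
replace (mult (z : C_AbsRing) w) with (mult (w : C_AbsRing) z) by apply Cmult_comm.
rewrite !minusE, !opp_plus, !opp_opp, <- !plus_assoc; f_equal.
rewrite !plus_assoc; f_equal; apply plus_comm.
Qed.

Lemma resolvent_comm {X : NormedModule C_AbsRing} (T : X -> X) z w Rz Rw x :
  is_linear T -> is_resolvent T z Rz -> is_resolvent T w Rw ->
  Rz (Rw x) = Rw (Rz x).
Proof.
intros HT [Hz1 Hz2] [Hw1 Hw2].
rewrite <- (Hz2 (Rw (Rz x))), <- (Hw2 (shifted z T (Rw (Rz x)))).
now rewrite (shifted_comm T w z), Hw1, Hz1 by easy.
Qed.

(** The product of the resolvents at the [p + 1] consecutive nodes [s, ..., s + p]. It plays the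
    role of the power [R^(p+1)], that is, of a [p]-th derivative of the resolvent. *)
Fixpoint resprod {X : NormedModule C_AbsRing} (Res : C -> X -> X) (h : R)
  (p s : nat) (x : X) : X :=
  match p with
  | O => Res (node h s) x
  | S p => Res (node h (s + S p)) (resprod Res h p s x)
  end.

Lemma resprod_left {X : NormedModule C_AbsRing} (T : X -> X) Res h p s x :
  is_linear T -> (forall s, is_resolvent T (node h s) (Res (node h s))) ->
  resprod Res h (S p) s x = Res (node h s) (resprod Res h p (S s) x).
Proof.
intros HT HR; induction p as [|p IH].
- simpl; rewrite Nat.add_1_r; apply (resolvent_comm T _ _ _ _ _ HT (HR _) (HR _)).
- change (resprod Res h (S (S p)) s x)
    with (Res (node h (s + S (S p))) (resprod Res h (S p) s x)).
  rewrite IH, (resolvent_comm T _ _ _ _ _ HT (HR _) (HR _)).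
  simpl; repeat f_equal; lia.
Qed.

(** The resolvent identity for products: both terms are the longer product with one resolvent
    undone, at its last node and at its first node respectively, so [T] cancels and the difference
    of the two nodes remains. *)
Lemma resprod_diff {X : NormedModule C_AbsRing} (T : X -> X) Res h p s x :
  is_linear T -> (forall s, is_resolvent T (node h s) (Res (node h s))) ->
  minus (resprod Res h p s x) (resprod Res h p (S s) x)
  = scal (node h s * (cis (h * INR (S p)) - 1))%C (resprod Res h (S p) s x).
Proof.
intros HT HR.
set (w := resprod Res h (S p) s x).
assert (H1 : resprod Res h p s x = shifted (node h (s + S p)) T w).
{ unfold w; simpl; now rewrite (proj1 (HR _)). }
assert (H2 : resprod Res h p (S s) x = shifted (node h s) T w).
{ unfold w; rewrite (resprod_left T) by easy; now rewrite (proj1 (HR _)). }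
rewrite H1, H2; unfold shifted; rewrite minus_minus_l.
transitivity (scal (minus (node h (s + S p) : C_AbsRing) (node h s)) w).
- symmetry; exact (scal_minus_distr_r (node h (s + S p) : C_AbsRing) (node h s) w).
- f_equal; rewrite node_add; exact (ltac:(ring) :
    (node h s * cis (h * INR (S p)) - node h s = node h s * (cis (h * INR (S p)) - 1))%C).
Qed.

Lemma resprod_le {X : NormedModule C_AbsRing} (Res : C -> X -> X) h p s x M :
  0 <= M ->
  (forall b, (b <= p)%nat -> forall y, norm (Res (node h (s + b)) y) <= M * norm y) ->
  norm (resprod Res h p s x) <= M ^ S p * norm x.
Proof.
intros HM; induction p as [|p IH]; intros H.
- generalize (H 0%nat (le_n _) x); rewrite Nat.add_0_r; simpl; lra.
- simpl resprod; eapply Rle_trans; [apply H; lia|].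
  change (M ^ S (S p)) with (M * M ^ S p); rewrite Rmult_assoc.
  apply Rmult_le_compat_l; [easy|apply IH; intros; apply H; lia].
Qed.

Lemma periodic_resprod {X : NormedModule C_AbsRing} (Res : C -> X -> X) h P p x :
  Rabs h * INR P = 2 * PI -> periodic P (fun s => resprod Res h p s x).
Proof.
intros Hh s; induction p as [|p IH]; simpl.
- now rewrite (periodic_node h P Hh).
- rewrite IH; replace (s + P + S p)%nat with (s + S p + P)%nat by lia.
  now rewrite (periodic_node h P Hh).
Qed.

(** * Frequency sums and their summation by parts *)

Definition nodepow (h : R) (s n : nat) : C := cis (h * (INR s + / 2) * INR n).

Lemma nodepow_S h s n : nodepow h s (S n) = (nodepow h s n * node h s)%C.
Proof.
unfold nodepow, node; rewrite <- cis_plus, S_INR; f_equal; ring.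
Qed.

Lemma nodepow_add h s u n :
  nodepow h (s + u) n = (cis (h * INR u * INR n) * nodepow h s n)%C.
Proof.
unfold nodepow; rewrite <- cis_plus, plus_INR; f_equal; ring.
Qed.

Lemma periodic_nodepow h P n : Rabs h * INR P = 2 * PI ->
  periodic P (fun s => nodepow h s n).
Proof.
intros Hh s; rewrite nodepow_add.
replace (h * INR P * INR n) with (h * IZR (Z.of_nat n) * INR P)
  by (rewrite <- INR_IZR_INZ; ring).
rewrite cis_full_turn by easy; ring.
Qed.

(** The discrete counterpart of the contour integral of [lambda^n f R^(p+1)] with respect to the
    angle. *)
Definition freq_sum {X : NormedModule C_AbsRing} (Res : C -> X -> X) (h : R)
  (P : nat) (f : nat -> C) (p n : nat) (x : X) : X :=
  psum (fun s => scal (nodepow h s n * f s)%C (resprod Res h p s x)) P.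

Lemma psum_minus {G : AbelianGroup} (f g : nat -> G) n :
  psum (fun i => minus (f i) (g i)) n = minus (psum f n) (psum g n).
Proof.
induction n as [|n IH]; simpl.
- now rewrite minus_eq_zero.
- rewrite IH; rewrite !minusE, opp_plus, <- !plus_assoc; f_equal.
  rewrite !plus_assoc; f_equal; apply plus_comm.
Qed.

Lemma scal_product_diff {K : Ring} {V : ModuleSpace K} (c a b : K) (v w : V) :
  minus (scal (mult c a) v) (scal (mult c b) w)
  = plus (scal (mult c (minus a b)) v) (scal (mult c b) (minus v w)).
Proof.
rewrite <- !scal_assoc, scal_minus_distr_r, !scal_minus_distr_l.
rewrite !minusE, <- plus_assoc; f_equal.
rewrite plus_assoc.
exact (eq_sym (eq_trans (f_equal (fun t => plus t _) (plus_opp_l _)) (plus_zero_l _))).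
Qed.

(** A translation by one node multiplies [lambda^n] by [cis (h * INR n)], so the factor on the left,
    which stands for [n], produces a difference of [f] times the resolvent product. It falls either
    on [f], or on the product, which then gains one resolvent and, from [resprod_diff], one more
    power of the node. *)
Lemma freq_sum_by_parts {X : NormedModule C_AbsRing} (T : X -> X) Res h P f p n x :
  is_linear T -> (forall s, is_resolvent T (node h s) (Res (node h s))) ->
  Rabs h * INR P = 2 * PI -> periodic P f ->
  scal (1 - cis (- (h * INR n)))%C (freq_sum Res h P f p n x)
  = plus (freq_sum Res h P (grad f) p n x)
      (scal (cis (h * INR (S p)) - 1)%C
         (freq_sum Res h P (fun s => f (S s)) (S p) (S n) x)).
Proof.
intros HT HR Hh Hf.
set (a := fun s => scal (nodepow h s n * f s)%C (resprod Res h p s x)).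
assert (Ha : periodic P a).
{ intros s; unfold a; rewrite (Hf s), (periodic_nodepow h P n Hh s).
  now rewrite (periodic_resprod Res h P p x Hh s). }
set (b := fun s => scal (nodepow h s n * f (S s))%C (resprod Res h p (S s) x)).
assert (Hb : psum b P = scal (cis (- (h * INR n))) (psum a P)).
{ rewrite <- (psum_shift a P 1 Ha), <- psum_scal.
  apply psum_ext; intros s _; unfold a, b.
  rewrite scal_assoc, nodepow_add, Nat.add_1_r; f_equal.
  change (@mult C_AbsRing) with Cmult.
  rewrite !Cmult_assoc, <- cis_plus.
  replace (- (h * INR n) + h * INR 1 * INR n) with 0 by (simpl; ring).
  rewrite cis_0; nring. }
change (freq_sum Res h P f p n x) with (psum a P).
change (1 - cis (- (h * INR n)))%C with (minus (one : C_Ring) (cis (- (h * INR n)) : C_Ring)).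
rewrite (scal_minus_distr_r (K := C_Ring)), scal_one, <- Hb.
transitivity (psum (fun s => minus (a s) (b s)) P).
{ symmetry; exact (psum_minus a b P). }
unfold freq_sum; rewrite <- psum_scal, <- psum_plus.
apply psum_ext; intros s _; unfold a, b.
etransitivity.
{ exact (scal_product_diff (K := C_Ring) (V := X) (nodepow h s n) (f s) (f (S s))
    (resprod Res h p s x) (resprod Res h p (S s) x)). }
f_equal.
etransitivity.
{ exact (f_equal (scal (nodepow h s n * f (S s) : C_AbsRing)%C)
    (resprod_diff T Res h p s x HT HR)). }
rewrite !scal_assoc, nodepow_S; f_equal.
change (@mult (AbsRing.Ring C_AbsRing)) with Cmult; change (@mult C_Ring) with Cmult; nring.
Qed.

(** A shifted and rescaled Pochhammer symbol, the product of [b + i * M] over [p < i <= p + j]; for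
    [b = 0] and [p = 0] it is [j! * M^j]. *)
Fixpoint rising (b M : R) (p j : nat) : R :=
  match j with
  | O => 1
  | S j => (b + INR (S p) * M) * rising b M (S p) j
  end.

Lemma rising_S b M p j :
  rising b M p (S j) = (b + INR (S p) * M) * rising b M (S p) j.
Proof. easy. Qed.

Lemma rising_ge_0 b M p j : 0 <= b -> 0 <= M -> 0 <= rising b M p j.
Proof.
intros Hb HM; revert p; induction j as [|j IH]; intros p; [simpl; lra|rewrite ?rising_S].
apply Rmult_le_pos; [|apply IH].
apply Rplus_le_le_0_compat; [easy|apply Rmult_le_pos; [apply pos_INR|easy]].
Qed.

Lemma rising_S_le b M p j : 0 <= b -> 0 <= M ->
  rising b M p j <= rising b M (S p) j.
Proof.
intros Hb HM; revert p; induction j as [|j IH]; intros p; [simpl; lra|rewrite ?rising_S].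
generalize (pos_INR (S p)); intros Hp.
apply Rmult_le_compat; [nra|now apply rising_ge_0| |apply IH].
rewrite (S_INR (S p)); nra.
Qed.

Lemma iter_grad_shift f l s :
  Nat.iter l grad (fun t => f (S t)) s = Nat.iter l grad f (S s).
Proof.
revert s; induction l as [|l IH]; intros s; [easy|].
simpl; unfold grad; now rewrite !IH.
Qed.

Lemma Cmod_1_minus_cis_opp x : Cmod (1 - cis (- x)) = Cmod (1 - cis x).
Proof.
rewrite <- cis_conj, <- (Cmod_conj (1 - cis x)); f_equal.
unfold Cconj; apply injective_projections; simpl; ring.
Qed.

Lemma norm_scal_C {X : NormedModule C_AbsRing} (z : C) (x : X) :
  norm (scal z x) <= Cmod z * norm x.
Proof. exact (norm_scal (z : C_AbsRing) x). Qed.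

(** Each summation by parts costs [h * beta] if the difference falls on [f], and [h * (p + 1) * M]
    if it falls on the resolvents; this [h] cancels against the one in [h * N]. Since [rising] is
    monotone in [p], the two branches merge into one factor, so no count of [2^j] terms appears. The
    exponent rises by at most [j], hence the range of [nu]; differences look ahead by one node each,
    hence the resolvent bound is required at nodes near the support of [f]. *)
Lemma freq_sum_le {X : NormedModule C_AbsRing} (T : X -> X) Res h P x M rho beta N :
  is_linear T -> (forall s, is_resolvent T (node h s) (Res (node h s))) ->
  0 < h -> h * INR P = 2 * PI -> 0 <= M -> 0 <= beta -> 0 < rho -> 0 < N ->
  forall j p n f B, periodic P f -> 0 <= B ->
  (forall nu, (n <= nu <= n + j)%nat -> h * N <= rho * Cmod (1 - cis (h * INR nu))) ->
  (forall l s, (l <= j)%nat -> Cmod (Nat.iter l grad f s) <= B * (h * beta) ^ l) ->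
  (forall s a b, (a <= j)%nat -> (b <= p + j)%nat -> f (s + a)%nat <> RtoC 0 ->
     forall y, norm (Res (node h (s + b)) y) <= M * norm y) ->
  norm (freq_sum Res h P f p n x)
  <= INR P * B * M ^ S p * (rho / N) ^ j * rising beta M p j * norm x.
Proof.
intros HT HR Hh0 Hh HM Hbeta Hrho HN.
assert (Hh' : Rabs h * INR P = 2 * PI) by (rewrite Rabs_pos_eq; lra).
induction j as [|j IH]; intros p n f B Hf HB Hnu Hgrad Hgood.
- replace (INR P * B * M ^ S p * (rho / N) ^ 0 * rising beta M p 0 * norm x)
    with (INR P * (B * (M ^ S p * norm x))) by (simpl; ring).
  unfold freq_sum; apply (norm_psum_le (V := X)); intros s _.
  eapply Rle_trans; [apply norm_scal_C|].
  rewrite Cmod_mult; unfold nodepow; rewrite Cmod_cis, Rmult_1_l.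
  (* The bound [M] on the resolvents is available only where [f] does not vanish. *)
  destruct (Ceq_dec (f s) 0) as [Hz|Hz].
  + rewrite Hz, Cmod_0, Rmult_0_l.
    apply Rmult_le_pos; [easy|apply Rmult_le_pos; [now apply pow_le|apply norm_ge_0]].
  + apply Rmult_le_compat; [apply Cmod_ge_0|apply norm_ge_0| |].
    * generalize (Hgrad 0%nat s (le_n _)); simpl; lra.
    * apply resprod_le; [easy|]; intros b Hb.
      apply (Hgood s 0%nat b); [lia|lia|now rewrite Nat.add_0_r].
- set (S0 := freq_sum Res h P f p n x).
  set (U := fun B' q => INR P * B' * M ^ S q * (rho / N) ^ j * rising beta M q j * norm x).
  assert (H1 : norm (freq_sum Res h P (grad f) p n x) <= U (B * (h * beta)) p).
  { apply IH.
    - intros s; unfold grad; now rewrite Hf, <- (Hf (S s)).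
    - apply Rmult_le_pos; [easy|nra].
    - intros; apply Hnu; lia.
    - intros l s Hl; rewrite <- Nat.iter_succ_r.
      eapply Rle_trans; [apply Hgrad; lia|]; right; simpl; ring.
    - intros s a b Ha Hb Hn.
      destruct (Ceq_dec (f (s + a)%nat) 0) as [Hz|Hz].
      + apply (Hgood s (S a) b); [lia|lia|].
        intros Hz'; apply Hn; unfold grad.
        rewrite <- Nat.add_succ_r, Hz, Hz'; ring.
      + apply (Hgood s a b); [lia|lia|easy]. }
  assert (H2 : norm (freq_sum Res h P (fun s => f (S s)) (S p) (S n) x) <= U B (S p)).
  { apply IH.
    - intros s; exact (Hf (S s)).
    - easy.
    - intros; apply Hnu; lia.
    - intros l s Hl; rewrite iter_grad_shift; apply Hgrad; lia.
    - intros s a b Ha Hb Hn; apply (Hgood s (S a) b); [lia|lia|].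
      now rewrite Nat.add_succ_r. }
  set (d := Cmod (1 - cis (h * INR n))).
  assert (Hd : h * N <= rho * d) by (apply Hnu; lia).
  assert (Hd0 : 0 < d) by (apply (Rmult_lt_reg_l rho); [easy|nra]).
  assert (HS : norm S0 <= / d * norm (scal (1 - cis (- (h * INR n)))%C S0)).
  { assert (Hne : (1 - cis (- (h * INR n)))%C <> RtoC 0).
    { apply Cmod_gt_0; rewrite Cmod_1_minus_cis_opp; exact Hd0. }
    rewrite <- (scal_one (V := X) S0) at 1.
    replace (one : C_AbsRing) with (mult (/ (1 - cis (- (h * INR n))) : C_AbsRing)%C
                                     (1 - cis (- (h * INR n)) : C_AbsRing)%C).
    - rewrite <- scal_assoc.
      eapply Rle_trans; [apply norm_scal_C|].
      right; f_equal; unfold d; rewrite <- Cmod_1_minus_cis_opp.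
      apply Cmod_inv; easy.
    - exact (Cinv_l _ Hne). }
  assert (HU : norm (scal (1 - cis (- (h * INR n)))%C S0)
    <= U (B * (h * beta)) p + h * INR (S p) * U B (S p)).
  { unfold S0; rewrite (freq_sum_by_parts T) by easy.
    eapply Rle_trans; [apply norm_triangle|].
    apply Rplus_le_compat; [easy|].
    eapply Rle_trans; [apply norm_scal_C|].
    apply Rmult_le_compat; [apply Cmod_ge_0|apply norm_ge_0| |easy].
    change (Cmod (cis (h * INR (S p)) - 1) <= h * INR (S p)).
    rewrite <- Cmod_opp.
    replace (- (cis (h * INR (S p)) - 1))%C with (1 - cis (h * INR (S p)))%C by ring.
    eapply Rle_trans; [apply Cmod_1_minus_cis_le|].
    rewrite Rabs_pos_eq; [lra|]; generalize (pos_INR (S p)); intros; nra. }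
  assert (Hdi : / d <= rho / N * / h).
  { apply (Rmult_le_reg_r (h * N * d)); [apply Rmult_lt_0_compat; nra|].
    replace (/ d * (h * N * d)) with (h * N) by (field; lra).
    replace (rho / N * / h * (h * N * d)) with (rho * d) by (field; lra).
    easy. }
  assert (Hc : 0 <= INR P * B * M ^ S p * (rho / N) ^ j * norm x).
  { repeat apply Rmult_le_pos; try easy; try apply pos_INR; try apply norm_ge_0;
      try (now apply pow_le); try apply pow_le.
    left; now apply Rdiv_lt_0_compat. }
  assert (Hp1 : 0 <= INR (S p)) by apply pos_INR.
  assert (HU' : U (B * (h * beta)) p + h * INR (S p) * U B (S p)
    <= h * (INR P * B * M ^ S p * (rho / N) ^ j * norm x)
         * rising beta M p (S j)).
  { unfold U; rewrite rising_S.
    generalize (rising_S_le beta M p j Hbeta HM); intros Hr.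
    assert (Hr' : beta * rising beta M p j <= beta * rising beta M (S p) j)
      by now apply Rmult_le_compat_l.
    change (M ^ S (S p)) with (M * M ^ S p).
    revert Hc Hr'; set (c0 := INR P * B * M ^ S p * (rho / N) ^ j * norm x); intros Hc Hr'.
    assert (Hr2 : h * c0 * (beta * rising beta M p j)
                  <= h * c0 * (beta * rising beta M (S p) j)).
    { apply Rmult_le_compat_l; [nra|easy]. }
    unfold c0 in *; nra. }
  eapply Rle_trans; [exact HS|].
  apply Rle_trans with (rho / N * / h * (h * (INR P * B * M ^ S p * (rho / N) ^ j * norm x)
         * rising beta M p (S j))).
  + apply Rmult_le_compat; [left; now apply Rinv_0_lt_compat|apply norm_ge_0|easy|].
    eapply Rle_trans; [exact HU|exact HU'].
  + right; simpl pow; field; lra.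
Qed.

(** * Recovering powers from resolvents *)

(** A real exponent makes negative powers available and keeps truncated subtraction out of the
    exponents. *)
Definition node_exp (h : R) (s : nat) (t : R) : C := cis (h * (INR s + / 2) * t).

Lemma node_exp_plus h s t u :
  node_exp h s (t + u) = (node_exp h s t * node_exp h s u)%C.
Proof.
unfold node_exp; rewrite <- cis_plus; f_equal; ring.
Qed.

(** The half-integer offset makes every node a root of [z^P = -1]; this is the origin of the sign in
    [x + T^P x]. *)
Lemma node_exp_period h P s : h * INR P = 2 * PI ->
  node_exp h s (- INR P) = RtoC (-1).
Proof.
intros Hh; unfold node_exp.
replace (h * (INR s + / 2) * - INR P) with (- PI + 2 * PI * IZR (- Z.of_nat s)).
- rewrite cis_period; unfold cis; rewrite cos_neg, sin_neg, cos_PI, sin_PI.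
  apply injective_projections; simpl; ring.
- rewrite opp_IZR, <- INR_IZR_INZ.
  transitivity (- (h * INR P) * (INR s + / 2)); [rewrite Hh; field|ring].
Qed.

Lemma plus_minus_plus {G : AbelianGroup} (a b c d : G) :
  minus (plus a b) (plus c d) = plus (minus a c) (minus b d).
Proof.
rewrite !minusE, opp_plus, <- !plus_assoc; f_equal.
rewrite !plus_assoc; f_equal; apply plus_comm.
Qed.


Lemma shifted_plus {X : NormedModule C_AbsRing} (T : X -> X) z x y : is_linear T ->
  shifted z T (plus x y) = plus (shifted z T x) (shifted z T y).
Proof.
intros HT; unfold shifted.
rewrite (linear_plus T HT).
exact (eq_trans (f_equal (fun t => minus t _) (scal_distr_l (V := X) (z : C_AbsRing) x y))
  (plus_minus_plus _ _ _ _)).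
Qed.

Lemma shifted_zero {X : NormedModule C_AbsRing} (T : X -> X) z : is_linear T ->
  shifted z T zero = zero.
Proof.
intros HT; unfold shifted.
assert (H0 : T zero = zero).
{ etransitivity; [apply f_equal; symmetry; exact (scal_zero_l (K := C_AbsRing) (zero : X))|].
  etransitivity; [exact (linear_scal T HT zero zero)|].
  exact (scal_zero_l (K := C_AbsRing) (T zero)). }
rewrite H0.
exact (eq_trans (f_equal (fun t => minus t _) (scal_zero_r (V := X) (z : C_AbsRing)))
  (minus_eq_zero _)).
Qed.

(** The Neumann series cut after one period telescopes to [x - lambda^(-P) T^P x]. As
    [lambda^P = -1] at all nodes, the remainder is the same vector [T^P x] everywhere. It is not
    small, but power-boundedness makes it harmless on the right-hand side. *)
Lemma resolvent_expansion {X : NormedModule C_AbsRing} (T Rz : X -> X) h P s x :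
  is_linear T -> is_resolvent T (node h s) Rz -> h * INR P = 2 * PI ->
  Rz (plus x (opow T P x))
  = psum (fun j => scal (node_exp h s (- INR (S j))) (opow T j x)) P.
Proof.
intros HT [_ HR] Hh.
assert (H : forall m, shifted (node h s) T
    (psum (fun j => scal (node_exp h s (- INR (S j))) (opow T j x)) m)
    = plus x (scal (- node_exp h s (- INR m))%C (opow T m x))).
{ induction m as [|m IH].
  - transitivity (zero : X); [exact (shifted_zero T (node h s) HT)|].
    replace (- node_exp h s (- INR 0))%C with (opp (one : C_Ring)).
    + symmetry; exact (eq_trans (f_equal (plus x) (scal_opp_one (K := C_Ring) (V := X) x))
        (plus_opp_r x)).
    + unfold node_exp; simpl INR; rewrite Ropp_0, Rmult_0_r, cis_0; easy.
  - change (psum (fun j => scal (node_exp h s (- INR (S j))) (opow T j x)) (S m))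
      with (plus (psum (fun j => scal (node_exp h s (- INR (S j))) (opow T j x)) m)
              (scal (node_exp h s (- INR (S m))) (opow T m x))).
    etransitivity; [exact (shifted_plus T _ _ _ HT)|].
    rewrite IH, <- plus_assoc; f_equal.
    set (y := opow T m x).
    change (opow T (S m) x) with (T y).
    unfold shifted; rewrite minusE, (linear_scal T HT), scal_assoc, plus_assoc.
    replace (- node_exp h s (- INR m))%C
      with (opp (mult (node h s : C_Ring) (node_exp h s (- INR (S m))))).
    + rewrite (scal_opp_l (K := C_Ring) (V := X) (mult _ _) y).
      etransitivity.
      { exact (f_equal (fun t => plus t _) (plus_opp_l (scal (mult (node h s : C_Ring)
          (node_exp h s (- INR (S m)))) y))). }
      rewrite plus_zero_l; symmetry.
      exact (scal_opp_l (K := C_Ring) (V := X) (node_exp h s (- INR (S m))) (T y)).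
    + change (- (node h s * node_exp h s (- INR (S m))) = - node_exp h s (- INR m))%C.
      f_equal; unfold node, node_exp; rewrite <- cis_plus, S_INR; f_equal; ring. }
rewrite <- HR, H; f_equal; f_equal.
rewrite node_exp_period by easy.
replace (- RtoC (-1))%C with (one : C_Ring); [symmetry; exact (scal_one _)|].
change (RtoC 1 = - RtoC (-1))%C; apply injective_projections; simpl; ring.
Qed.

Lemma freq_sum_expansion {X : NormedModule C_AbsRing} (T : X -> X) Res h P f n x :
  is_linear T -> (forall s, is_resolvent T (node h s) (Res (node h s))) ->
  h * INR P = 2 * PI ->
  freq_sum Res h P f 0 (S n) (plus x (opow T P x))
  = psum (fun j => scal (psum (fun s => f s * node_exp h s (INR n - INR j))%C P)
                        (opow T j x)) P.
Proof.
intros HT HR Hh; unfold freq_sum; simpl resprod.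
rewrite (psum_ext _ (fun s => psum (fun j =>
  scal (f s * node_exp h s (INR n - INR j))%C (opow T j x)) P)).
- rewrite psum_switch; apply psum_ext; intros j _.
  exact (psum_scal_r (K := C_Ring) (V := X) _ (opow T j x) P).
- intros s _; rewrite (resolvent_expansion T _ h P s x) by easy.
  rewrite <- psum_scal; apply psum_ext; intros j _.
  rewrite scal_assoc; f_equal.
  change (nodepow h s (S n) * f s * node_exp h s (- INR (S j))
          = f s * node_exp h s (INR n - INR j))%C.
  replace (INR n - INR j) with (INR (S n) + - INR (S j)) by (rewrite !S_INR; ring).
  rewrite node_exp_plus; unfold nodepow, node_exp; ring.
Qed.

Lemma freq_sum_one {X : NormedModule C_AbsRing} (T : X -> X) Res h P n x :
  is_linear T -> (forall s, is_resolvent T (node h s) (Res (node h s))) ->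
  Rabs h * INR P = 2 * PI -> h * INR P = 2 * PI -> (n < P)%nat ->
  freq_sum Res h P (fun _ => RtoC 1) 0 (S n) (plus x (opow T P x))
  = scal (RtoC (INR P)) (opow T n x).
Proof.
intros HT HR Hh' Hh Hn; rewrite (freq_sum_expansion T) by easy.
rewrite (psum_single _ _ n); [|easy|].
- f_equal; rewrite Rminus_diag.
  rewrite (psum_ext _ (fun _ => RtoC 1)).
  + rewrite <- psum_RtoC, psum_const, Rmult_1_r; easy.
  + intros s _; unfold node_exp; rewrite Rmult_0_r, cis_0; nring.
- intros j Hj Hjn.
  replace (psum _ P) with (RtoC 0); [exact (scal_zero_l (K := C_Ring) _)|].
  symmetry; rewrite (psum_ext _ (fun s => cis (h * / 2 * (INR n - INR j)) *
    cis (h * IZR (Z.of_nat n - Z.of_nat j) * INR s))%C).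
  + rewrite psum_Cmult, cis_orthogonality by (easy || lia); nring.
  + intros s _; unfold node_exp; rewrite minus_IZR, <- !INR_IZR_INZ, <- cis_plus.
    rewrite Cmult_1_l; f_equal; ring.
Qed.

(** By the expansion, the left side is a combination of the orbit whose coefficients are, up to
    phases, the Fourier coefficients of [damped h f] at the frequencies [j - n]. *)
Lemma freq_sum_diff_le {X : NormedModule C_AbsRing} (T : X -> X) Res h P f n x K :
  is_linear T -> (forall s, is_resolvent T (node h s) (Res (node h s))) ->
  Rabs h * INR P = 2 * PI -> h * INR P = 2 * PI -> (n <= P)%nat ->
  (forall j, norm (opow T j x) <= K) ->
  norm (minus (freq_sum Res h P f 0 (S n) (plus x (opow T P x)))
              (freq_sum Res h P f 0 (S (S n)) (plus x (opow T P x))))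
  <= fourier_l1 h P (damped h f) * K.
Proof.
intros HT HR Hh' Hh Hn HK; rewrite !(freq_sum_expansion T) by easy.
eapply Rle_trans; [right; apply f_equal; symmetry; exact (psum_minus _ _ P)|].
eapply Rle_trans; [apply (norm_psum (V := X))|].
(* Modulation by [P - n], that is by [- n] modulo [P], aligns the frequency [j - n] with the index
   [j]. *)
rewrite <- (fourier_l1_modulate h P _ (P - n)) by easy.
unfold fourier_l1; rewrite Rmult_comm, <- psum_Rmult.
apply psum_le; intros j _; rewrite Rmult_comm.
eapply Rle_trans; [|apply Rmult_le_compat_l; [apply Cmod_ge_0|apply (HK j)]].
eapply Rle_trans.
{ right; apply f_equal; symmetry.
  exact (scal_minus_distr_r (K := C_Ring) (V := X) _ _ _). }
eapply Rle_trans; [apply norm_scal_C|].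
apply Rmult_le_compat_r; [apply norm_ge_0|].
right.
rewrite <- (Rmult_1_l (Cmod (psum (fun s => _ * damped h f s * _)%C P))).
rewrite <- (Cmod_cis (h * / 2 * (INR n - INR j))), <- Cmod_mult; f_equal.
etransitivity; [symmetry; exact (psum_minus (G := C_AbelianGroup) _ _ P)|].
rewrite <- psum_Cmult; apply psum_ext; intros s _.
unfold damped.
change (@minus C_AbelianGroup) with Cminus.
replace (INR (S n) - INR j) with (1 + (INR n - INR j)) by (rewrite S_INR; ring).
rewrite node_exp_plus.
replace (node_exp h s 1) with (node h s)
  by (unfold node, node_exp; f_equal; ring).
replace (- (h * INR s * INR (P - n)))
  with (h * INR s * INR n + 2 * PI * IZR (- Z.of_nat s)).
2: { rewrite minus_INR, opp_IZR, <- INR_IZR_INZ, <- Hh by easy; ring. }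
rewrite cis_period.
transitivity (f s * (1 - node h s) * node_exp h s (INR n - INR j))%C; [nring|].
replace (node_exp h s (INR n - INR j)) with
  (cis (h * / 2 * (INR n - INR j)) * (cis (h * INR s * INR n) *
   cis (- (h * INR s * INR j))))%C; [nring|].
unfold node_exp; rewrite <- !cis_plus; f_equal; ring.
Qed.

Lemma freq_sum_plus {X : NormedModule C_AbsRing} (Res : C -> X -> X) h P f g p n x :
  freq_sum Res h P (fun s => f s + g s)%C p n x
  = plus (freq_sum Res h P f p n x) (freq_sum Res h P g p n x).
Proof.
unfold freq_sum; rewrite <- psum_plus; apply psum_ext; intros s _.
rewrite Cmult_plus_distr_l.
exact (scal_distr_r (K := C_Ring) (V := X) _ _ _).
Qed.

(** Only the low part exploits the cancellation between [T^n] and [T^(n+1)]. The high part is small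
    for each of the two powers separately, whence the factor 2. *)
Lemma power_difference_le {X : NormedModule C_AbsRing} (T : X -> X) Res h P phi n x K H :
  is_linear T -> (forall s, is_resolvent T (node h s) (Res (node h s))) ->
  0 < h -> h * INR P = 2 * PI -> (S n < P)%nat ->
  (forall j, norm (opow T j x) <= K) ->
  (forall i, (n <= i <= S n)%nat ->
    norm (freq_sum Res h P (fun s => 1 - phi s)%C 0 (S i) (plus x (opow T P x))) <= H) ->
  INR P * norm (minus (opow T n x) (opow T (S n) x))
  <= fourier_l1 h P (damped h phi) * K + 2 * H.
Proof.
intros HT HR Hh0 Hh Hn HK HH.
assert (Hh' : Rabs h * INR P = 2 * PI) by (rewrite Rabs_pos_eq; lra).
assert (HP : 0 < INR P) by (apply lt_0_INR; lia).
set (x' := plus x (opow T P x)) in *.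
set (y := minus (opow T n x) (opow T (S n) x)).
assert (Hsplit : forall i, freq_sum Res h P (fun _ => RtoC 1) 0 (S i) x'
  = plus (freq_sum Res h P phi 0 (S i) x')
         (freq_sum Res h P (fun s => 1 - phi s)%C 0 (S i) x')).
{ intros i; rewrite <- freq_sum_plus; apply psum_ext; intros s _.
  f_equal; f_equal; ring. }
assert (Hy : scal (RtoC (INR P)) y
  = plus (minus (freq_sum Res h P phi 0 (S n) x') (freq_sum Res h P phi 0 (S (S n)) x'))
      (minus (freq_sum Res h P (fun s => 1 - phi s)%C 0 (S n) x')
             (freq_sum Res h P (fun s => 1 - phi s)%C 0 (S (S n)) x'))).
{ unfold y; etransitivity.
  { exact (scal_minus_distr_l (K := C_Ring) (V := X) (RtoC (INR P)) _ _). }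
  rewrite <- !(freq_sum_one T Res h P) by (easy || lia).
  fold x'; rewrite !Hsplit; exact (plus_minus_plus (G := NormedModule.AbelianGroup _ X) _ _ _ _). }
assert (Hn1 : INR P * norm y <= norm (scal (RtoC (INR P)) y)).
{ assert (He : y = scal (/ RtoC (INR P))%C (scal (RtoC (INR P)) y)).
  { rewrite scal_assoc; symmetry.
    etransitivity; [|exact (scal_one (K := C_Ring) y)]; f_equal.
    apply Cinv_l; intros Hc; apply RtoC_inj in Hc; lra. }
  apply (Rmult_le_reg_l (/ INR P)); [now apply Rinv_0_lt_compat|].
  rewrite <- Rmult_assoc, Rinv_l, Rmult_1_l by lra.
  rewrite He at 1; eapply Rle_trans; [apply norm_scal_C|].
  rewrite Cmod_inv_INR by lia; apply Rle_refl. }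
eapply Rle_trans; [exact Hn1|rewrite Hy].
eapply Rle_trans; [apply norm_triangle|].
apply Rplus_le_compat.
- apply (freq_sum_diff_le T); try easy; lia.
- rewrite minusE; eapply Rle_trans; [apply norm_triangle|].
  rewrite norm_opp; generalize (HH n ltac:(lia)) (HH (S n) ltac:(lia)); lra.
Qed.

(** * Optimizing the number of summations by parts *)

Lemma ln_le_sub_1 x : 0 < x -> ln x <= x - 1.
Proof.
intros Hx; generalize (exp_ineq1_le (ln x)); rewrite exp_ln by easy; lra.
Qed.

(** An antiderivative of [ln], used to compare the logarithm of a product with an integral. *)
Definition xlogx (x : R) : R := x * ln x - x.

Lemma ln_le_xlogx_diff y : 0 < y -> ln y <= xlogx (y + 1) - xlogx y.
Proof.
intros Hy; unfold xlogx.
assert (H : 1 <= (y + 1) * (ln (y + 1) - ln y)); [|lra].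
assert (H1 : ln (y / (y + 1)) <= y / (y + 1) - 1).
{ apply ln_le_sub_1, Rdiv_lt_0_compat; lra. }
unfold Rdiv in H1 at 1; rewrite ln_mult, ln_Rinv in H1;
  [|lra|lra|apply Rinv_0_lt_compat; lra].
replace (y / (y + 1) - 1) with (- / (y + 1)) in H1 by (field; lra).
apply Rle_trans with ((y + 1) * / (y + 1)); [right; field; lra|].
apply Rmult_le_compat_l; lra.
Qed.

Lemma exp_le x y : x <= y -> exp x <= exp y.
Proof.
intros [H| ->]; [left; now apply exp_increasing|apply Rle_refl].
Qed.

Lemma rising_le_exp d M p k : 0 <= d -> 0 < M ->
  rising (d * M) M p k
  <= M ^ k * exp (xlogx (d + INR p + 1 + INR k) - xlogx (d + INR p + 1)).
Proof.
intros Hd HM; revert p; induction k as [|k IH]; intros p.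
- simpl; rewrite Rplus_0_r, Rminus_diag, exp_0; lra.
- assert (Hp := pos_INR p).
  assert (Hy : 0 < d + INR p + 1) by lra.
  rewrite rising_S.
  replace (d * M + INR (S p) * M) with ((d + INR p + 1) * M)
    by (rewrite S_INR; ring).
  eapply Rle_trans.
  { apply Rmult_le_compat_l; [nra|apply IH]. }
  set (y := d + INR p + 1) in *.
  replace (d + INR (S p) + 1) with (y + 1) by (unfold y; rewrite S_INR; ring).
  replace (y + INR (S k)) with (y + 1 + INR k) by (rewrite S_INR; ring).
  replace (y * M * (M ^ k * exp (xlogx (y + 1 + INR k) - xlogx (y + 1))))
    with (M ^ S k * (y * exp (xlogx (y + 1 + INR k) - xlogx (y + 1)))) by (simpl; ring).
  apply Rmult_le_compat_l; [apply pow_le; lra|].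
  rewrite <- (exp_ln y) at 1 by easy; rewrite <- exp_plus.
  assert (H := ln_le_xlogx_diff y Hy).
  apply exp_le; lra.
Qed.

Lemma ln_1_plus_le t y : 0 < t <= 1 -> 0 <= y -> ln (1 + y) <= t * y + / t.
Proof.
intros Ht Hy.
assert (Hti : 0 < / t) by (apply Rinv_0_lt_compat; lra).
replace (1 + y) with (t * (1 + y) * / t) by (field; lra).
rewrite ln_mult by nra.
generalize (ln_le_sub_1 (t * (1 + y)) ltac:(nra)) (ln_le_sub_1 (/ t) Hti); lra.
Qed.

Lemma rising_mono b b' M p k : 0 <= b <= b' -> 0 <= M ->
  rising b M p k <= rising b' M p k.
Proof.
intros Hb HM; revert p; induction k as [|k IH]; intros p; [apply Rle_refl|].
rewrite !rising_S.
assert (Hp : 0 <= INR (S p) * M) by (apply Rmult_le_pos; [apply pos_INR|easy]).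
apply Rmult_le_compat; [lra|apply rising_ge_0; lra|lra|apply IH].
Qed.

(* Stirling: [k! (M / N)^k] is about [exp (- k)] when [k M <= N]; the slack
   [exp (- 4 t)] pays for the perturbation [b] and for the factor [exp t]. *)
Lemma rising_decay t N M b k : 0 < t <= 1 -> 0 < N -> 0 < M ->
  0 <= b <= t ^ 2 * INR k * M -> INR k * M <= exp (- (4 * t)) * N ->
  (exp t / N) ^ k * rising b M 0 k <= exp (1 + / t - INR k).
Proof.
intros Ht HN HM Hb Hk.
assert (Hti : 1 <= / t) by (rewrite <- Rinv_1; apply Rinv_le_contravar; lra).
destruct k as [|k'].
{ simpl; apply Rle_trans with (exp 0); [rewrite exp_0|apply exp_le]; lra. }
set (k := S k') in *.
assert (Hk0 : 1 <= INR k) by (apply (le_INR 1); unfold k; lia).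
set (d := t ^ 2 * INR k).
assert (Hd : 0 <= d) by (unfold d; nra).
assert (Hpow : forall x, 0 < x -> x ^ k = exp (INR k * ln x)).
{ intros x Hx; rewrite <- Rpower_pow by easy; easy. }
eapply Rle_trans.
{ apply Rmult_le_compat_l.
  - apply pow_le; left; apply Rdiv_lt_0_compat; [apply exp_pos|easy].
  - eapply Rle_trans; [apply (rising_mono b (d * M)); [exact Hb|lra]|].
    apply rising_le_exp; [easy|easy]. }
rewrite <- Rmult_assoc, <- Rpow_mult_distr, Hpow.
2: { apply Rmult_lt_0_compat; [apply Rdiv_lt_0_compat; [apply exp_pos|easy]|easy]. }
rewrite <- exp_plus; apply exp_le.
simpl (INR 0); rewrite Rplus_0_r.
set (D := d + 1).
assert (HD : 1 <= D) by (unfold D; lra).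
assert (H1 : ln (exp t / N * M) <= - (3 * t) - ln (INR k)).
{ replace (exp t / N * M) with (exp t * (INR k * M / N) / INR k) by (field; lra).
  assert (Hq : 0 < INR k * M / N) by (apply Rdiv_lt_0_compat; nra).
  unfold Rdiv at 1; rewrite ln_mult, ln_Rinv, ln_mult, ln_exp;
    [|apply exp_pos|easy|lra|apply Rmult_lt_0_compat; [apply exp_pos|easy]
     |apply Rinv_0_lt_compat; lra].
  assert (ln (INR k * M / N) <= - (4 * t)); [|lra].
  rewrite <- (ln_exp (- (4 * t))); apply Rcomplements.ln_le; [easy|].
  apply (Rmult_le_reg_r N); [easy|]; unfold Rdiv.
  rewrite Rmult_assoc, Rinv_l by lra; lra. }
(* The three terms [t * k] are one from [D], which bounds [k ln (1 + D / k)], and two from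
   [D ln (1 + k / D)], where [d = t^2 k] gives [D / t = t k + 1 / t]. They cancel against the
   [- 3 t] of [H1]. *)
assert (H2 : xlogx (D + INR k) - xlogx D
  <= INR k * ln (INR k) - INR k + 3 * t * INR k + 1 + / t).
{ unfold xlogx.
  assert (Ha : ln (D + INR k) = ln (INR k) + ln (1 + D / INR k)).
  { rewrite <- ln_mult by (try (assert (0 < D / INR k) by (apply Rdiv_lt_0_compat; lra)); lra).
    f_equal; field; lra. }
  assert (Hb' : ln (D + INR k) = ln D + ln (1 + INR k / D)).
  { rewrite <- ln_mult by (try (assert (0 < INR k / D) by (apply Rdiv_lt_0_compat; lra)); lra).
    f_equal; field; lra. }
  assert (Hc : INR k * ln (1 + D / INR k) <= D).
  { assert (Hdk : 0 < D / INR k) by (apply Rdiv_lt_0_compat; lra).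
    generalize (ln_le_sub_1 (1 + D / INR k) ltac:(lra)); intros Hl.
    apply Rle_trans with (INR k * (D / INR k)); [apply Rmult_le_compat_l; lra|].
    right; field; lra. }
  assert (He : D * ln (1 + INR k / D) <= t * INR k + D * / t).
  { assert (Hdk : 0 < INR k / D) by (apply Rdiv_lt_0_compat; lra).
    apply Rle_trans with (D * (t * (INR k / D) + / t)).
    - apply Rmult_le_compat_l; [lra|apply ln_1_plus_le; lra].
    - right; field; lra. }
  assert (Hf : D * / t = t * INR k + / t) by (unfold D, d; field; lra).
  assert (Hg : D <= t * INR k + 1).
  { assert (t * (t * INR k) <= 1 * (t * INR k)).
    { apply Rmult_le_compat_r; [apply Rmult_le_pos; lra|lra]. }
    unfold D, d; simpl pow; lra. }
  replace ((D + INR k) * ln (D + INR k) - (D + INR k) - (D * ln D - D))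
    with (INR k * ln (D + INR k) + D * (ln (D + INR k) - ln D) - INR k) by ring.
  rewrite Ha at 1; rewrite Hb'; nra. }
nra.
Qed.

(** The common end of both regimes: [phi = 0] gives the estimate without cutoff. The range of [nu]
    reaches [n + k + 2] because the high part carries the exponents [n + 1] and [n + 2], raised by
    at most [k]. *)
Lemma power_difference_decay {X : NormedModule C_AbsRing} (T : X -> X) Res h P phi
  n k x K M beta t B c0 :
  is_linear T -> (forall s, is_resolvent T (node h s) (Res (node h s))) ->
  (forall j y, norm (opow T j y) <= K * norm y) ->
  0 < h -> h * INR P = 2 * PI -> (1 <= n)%nat -> (S n < P)%nat ->
  0 < t <= 1 -> 0 < M -> 0 <= B -> 0 <= K ->
  0 <= beta <= t ^ 2 * INR k * M -> INR k * M <= exp (- (4 * t)) * INR n ->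
  (forall nu, (n <= nu <= n + k + 2)%nat ->
     h * INR nu <= exp t * Cmod (1 - cis (h * INR nu))) ->
  periodic P phi -> fourier_l1 h P (damped h phi) <= INR P * c0 ->
  (forall l s, (l <= k)%nat ->
     Cmod (Nat.iter l grad (fun r => 1 - phi r)%C s) <= B * (h * beta) ^ l) ->
  (forall s a b, (a <= k)%nat -> (b <= k)%nat -> phi (s + a)%nat <> RtoC 1 ->
     forall y, norm (Res (node h (s + b)) y) <= M * norm y) ->
  norm (minus (opow T n x) (opow T (S n) x))
  <= (c0 * K + 2 * (B * M * exp (1 + / t - INR k) * (1 + K))) * norm x.
Proof.
intros HT HR HK Hh0 Hh Hn HnP Ht HM HB HK0 Hbeta Hk Hnu Hphi Hl1 Hgrad Hgood.
assert (HP : 0 < INR P) by (apply lt_0_INR; lia).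
assert (Hn0 : 0 < INR n) by (apply lt_0_INR; lia).
set (H := INR P * (B * M * exp (1 + / t - INR k) * ((1 + K) * norm x))).
apply (Rmult_le_reg_l (INR P)); [easy|].
eapply Rle_trans.
{ apply (power_difference_le T Res h P phi n x (K * norm x) H); try easy.
  intros i Hi.
  eapply Rle_trans.
  { apply (freq_sum_le T Res h P _ M (exp t) beta (INR n) HT HR Hh0 Hh) with (j := k) (B := B);
      [lra|lra|apply exp_pos|easy| |easy| |exact Hgrad|].
    - intros s; now rewrite Hphi.
    - intros nu Hnu'; eapply Rle_trans; [|apply Hnu; lia].
      apply Rmult_le_compat_l; [lra|apply le_INR; lia].
    - intros s a b Ha Hb Hne; apply (Hgood s a b Ha Hb).
      intros He; apply Hne; rewrite He; ring. }
  assert (Hx : norm (plus x (opow T P x)) <= (1 + K) * norm x).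
  { eapply Rle_trans; [apply norm_triangle|]; generalize (HK P x); lra. }
  assert (Hdec := rising_decay t (INR n) M beta k Ht Hn0 HM Hbeta Hk).
  unfold H.
  replace (INR P * B * M ^ 1 * (exp t / INR n) ^ k * rising beta M 0 k
     * norm (plus x (opow T P x)))
    with (INR P * B * M * ((exp t / INR n) ^ k * rising beta M 0 k
     * norm (plus x (opow T P x)))) by ring.
  replace (INR P * (B * M * exp (1 + / t - INR k) * ((1 + K) * norm x)))
    with (INR P * B * M * (exp (1 + / t - INR k) * ((1 + K) * norm x))) by ring.
  apply Rmult_le_compat_l; [repeat apply Rmult_le_pos; lra|].
  apply Rmult_le_compat; [|apply norm_ge_0|easy|easy].
  apply Rmult_le_pos; [|apply rising_ge_0; lra].
  apply pow_le; left; apply Rdiv_lt_0_compat; [apply exp_pos|easy]. }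
unfold H.
assert (Hx := norm_ge_0 x).
assert (fourier_l1 h P (damped h phi) * (K * norm x) <= INR P * c0 * (K * norm x)).
{ apply Rmult_le_compat_r; [now apply Rmult_le_pos|easy]. }
lra.
Qed.

(** * Decay estimates *)

(** The distance of [x] to [2 * PI * Z] replaces a reduced angle, since the angles of the nodes are
    never reduced modulo [2 * PI]. *)
Definition resolvent_bound {X : NormedModule C_AbsRing} (T : X -> X)
  (Res : C -> X -> X) (m : R -> R) : Prop :=
  forall x eps, 0 < eps <= PI -> (forall j : Z, eps <= Rabs (x - 2 * PI * IZR j)) ->
    is_resolvent T (cis x) (Res (cis x)) /\
    (forall y, norm (Res (cis x) y) <= m eps * norm y).

Lemma node_resolvent {X : NormedModule C_AbsRing} (T : X -> X) Res m h P s :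
  resolvent_bound T Res m -> 0 < h -> h * INR P = 2 * PI -> (1 <= P)%nat ->
  is_resolvent T (node h s) (Res (node h s)) /\
  (forall y, norm (Res (node h s) y) <= m (h / 2) * norm y).
Proof.
intros HR Hh0 Hh HP; apply HR.
- assert (1 <= INR P) by (apply (le_INR 1); lia); split; nra.
- intros j; rewrite <- Hh, (INR_IZR_INZ s), (INR_IZR_INZ P).
  replace (h * (IZR (Z.of_nat s) + / 2) - h * IZR (Z.of_nat P) * IZR j)
    with (h * (IZR (Z.of_nat s - Z.of_nat P * j) + / 2))
    by (rewrite minus_IZR, mult_IZR; ring).
  rewrite Rabs_mult, (Rabs_pos_eq h) by lra.
  apply Rmult_le_compat_l; [lra|].
  generalize (Z.of_nat s - Z.of_nat P * j)%Z; intros d.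
  (* A half-integer has absolute value at least 1/2. *)
  destruct (Z_lt_le_dec d 0) as [Hd|Hd].
  + assert (IZR d <= -1) by (apply IZR_le; lia).
    rewrite Rabs_left; lra.
  + apply IZR_le in Hd; rewrite Rabs_pos_eq; lra.
Qed.

Lemma iter_grad_one_minus phi l s : (1 <= l)%nat ->
  Nat.iter l grad (fun r => 1 - phi r)%C s = (- Nat.iter l grad phi s)%C.
Proof.
intros Hl; destruct l as [|l]; [lia|clear Hl].
revert s; induction l as [|l IH]; intros s.
- simpl; unfold grad; ring.
- change (Nat.iter (S l) grad (fun r => 1 - phi r)%C s -
          Nat.iter (S l) grad (fun r => 1 - phi r)%C (S s)
          = - (Nat.iter (S l) grad phi s - Nat.iter (S l) grad phi (S s)))%C.
  rewrite !IH; ring.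
Qed.

Lemma iter_grad_zero l s : Nat.iter l grad (fun _ => RtoC 0) s = RtoC 0.
Proof.
revert s; induction l as [|l IH]; intros s; [easy|].
change (Nat.iter l grad (fun _ => RtoC 0) s - Nat.iter l grad (fun _ => RtoC 0) (S s)
        = RtoC 0)%C.
rewrite !IH; ring.
Qed.

Lemma fourier_l1_damped_zero h P : fourier_l1 h P (damped h (fun _ => RtoC 0)) = 0.
Proof.
transitivity (psum (fun _ => 0) P); [|rewrite psum_const; nring].
apply psum_ext; intros e _.
replace (psum _ P) with (RtoC 0); [apply Cmod_0|].
symmetry; apply (psum_zero (G := C_AbelianMonoid)); intros s _; unfold damped.
change (@zero C_AbelianMonoid) with (RtoC 0); nring.
Qed.

Lemma exists_small_exponent q : 0 < q < 1 ->
  exists t, 0 < t <= 1 /\ q <= exp (- (4 * t)).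
Proof.
intros Hq.
assert (Hl : ln q < 0) by (rewrite <- ln_1; apply ln_increasing; lra).
exists (Rmin 1 (- ln q / 4)).
assert (H1 := Rmin_l 1 (- ln q / 4)); assert (H2 := Rmin_r 1 (- ln q / 4)).
split.
- split; [apply Rmin_glb_lt; lra|easy].
- rewrite <- (exp_ln q) at 1 by lra; apply exp_le; lra.
Qed.

Lemma circle_bound_decay {X : NormedModule C_AbsRing} (T : X -> X) Res M K q :
  is_linear T -> (forall j y, norm (opow T j y) <= K * norm y) -> 0 <= K ->
  0 < M -> resolvent_bound T Res (fun _ => M) -> 0 < q < 1 ->
  exists c, 0 <= c /\ forall n x, (1 <= n)%nat ->
    norm (minus (opow T n x) (opow T (S n) x)) <= c * exp (- (q * INR n / M)) * norm x.
Proof.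
intros HT HK HK0 HM HR Hq.
destruct (exists_small_exponent q Hq) as [t [Ht Hqt]].
exists (2 * (M * exp (2 + / t) * (1 + K))); split.
{ assert (Ht' := exp_pos (2 + / t)); repeat apply Rmult_le_pos; lra. }
intros n x Hn.
assert (Hn0 : 0 < INR n) by (apply lt_0_INR; lia).
(* The largest order with [k * M <= q * n]. Rounding down costs a factor [e], which turns
   [exp (1 + / t)] into [exp (2 + / t)]. *)
destruct (nfloor_ex (q * INR n / M)) as [k Hk].
{ left; apply Rdiv_lt_0_compat; nra. }
destruct (Cmod_1_minus_cis_ge (exp t)) as [x0 [Hx0 Hcis]].
{ rewrite <- exp_0; apply exp_increasing; lra. }
(* The mesh is made so fine that all angles [h * nu] involved lie below [x0], where arc and chord
   agree up to the factor [exp t]. That [P] depends on [n] is harmless. *)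
destruct (nfloor_ex (2 * PI * (INR n + INR k + 2) / x0)) as [p Hp].
{ left; apply Rdiv_lt_0_compat; [|easy].
  generalize (pos_INR k) PI_RGT_0; intros; nra. }
set (P := (p + n + 2)%nat).
assert (HP : 0 < INR P) by (apply lt_0_INR; unfold P; lia).
set (h := 2 * PI / INR P).
assert (Hh0 : 0 < h) by (apply Rdiv_lt_0_compat; [generalize PI_RGT_0; lra|easy]).
assert (Hh : h * INR P = 2 * PI) by (unfold h; field; lra).
assert (Hsmall : h * (INR n + INR k + 2) < x0).
{ assert (HpP : INR p + 1 <= INR P).
  { rewrite <- S_INR; apply le_INR; unfold P; lia. }
  assert (H1 : 2 * PI * (INR n + INR k + 2) < x0 * INR P).
  { replace (2 * PI * (INR n + INR k + 2))
      with (x0 * (2 * PI * (INR n + INR k + 2) / x0)) by (field; lra).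
    apply Rmult_lt_compat_l; lra. }
  apply (Rmult_lt_reg_r (INR P)); [easy|].
  replace (h * (INR n + INR k + 2) * INR P) with (h * INR P * (INR n + INR k + 2)) by ring.
  rewrite Hh; lra. }
assert (HkM : INR k * M <= q * INR n).
{ replace (q * INR n) with (q * INR n / M * M) by (field; lra).
  apply Rmult_le_compat_r; lra. }
assert (HRn : forall s, is_resolvent T (node h s) (Res (node h s)) /\
  (forall y, norm (Res (node h s) y) <= M * norm y)).
{ intros s; apply (node_resolvent T Res (fun _ => M) h P); try easy; unfold P; lia. }
eapply Rle_trans.
{ apply (power_difference_decay T Res h P (fun _ => RtoC 0) n k x K M 0 t 1 0);
    try easy; try lra.
  - intros s; apply HRn.
  - unfold P; lia.
  - split; [lra|]; repeat apply Rmult_le_pos; try apply pos_INR; lra.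
  - eapply Rle_trans; [exact HkM|]; apply Rmult_le_compat_r; lra.
  - intros nu Hnu; apply Hcis.
    assert (0 < INR nu) by (apply lt_0_INR; lia).
    assert (INR nu <= INR n + INR k + 2).
    { replace (INR n + INR k + 2) with (INR (n + k + 2)) by (rewrite !plus_INR; simpl; ring).
      apply le_INR; lia. }
    split; nra.
  - rewrite Rmult_0_r, fourier_l1_damped_zero; lra.
  - intros l s Hl; destruct l as [|l].
    + simpl; replace (1 - 0)%C with (RtoC 1) by ring; rewrite Cmod_1; lra.
    + rewrite iter_grad_one_minus, iter_grad_zero by lia.
      rewrite Cmod_opp, Cmod_0, Rmult_0_r, pow_ne_zero by easy; lra.
  - intros s a b _ _ _; apply HRn. }
apply Rmult_le_compat_r; [apply norm_ge_0|].
rewrite Rmult_0_l, Rplus_0_l, Rmult_1_l.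
replace (2 * (M * exp (2 + / t) * (1 + K)) * exp (- (q * INR n / M)))
  with (2 * (M * (exp (2 + / t) * exp (- (q * INR n / M))) * (1 + K))) by ring.
rewrite <- exp_plus.
apply Rmult_le_compat_l; [lra|]; apply Rmult_le_compat_r; [lra|].
apply Rmult_le_compat_l; [lra|]; apply exp_le; lra.
Qed.

(** If the node [s + b] were within [eps] of 1, its index would lie within [W / 2] of a multiple of
    [P]. Passing to [s + a] costs at most [k + 1/2 <= W / 2] more, which stays in the plateau where
    [phi] is 1. *)
Lemma cutoff_support h P W k phi eps s a b (j : Z) :
  0 < h -> h * INR P = 2 * PI -> (1 <= k)%nat -> (4 * k <= W)%nat -> (4 * W <= P)%nat ->
  2 * eps <= INR W * h ->
  (forall s q r, (s + W = P * q + r)%nat -> (r <= 2 * W)%nat -> phi s = RtoC 1) ->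
  (a <= k)%nat -> (b <= k)%nat -> phi (s + a)%nat <> RtoC 1 ->
  eps <= Rabs (h * (INR (s + b) + / 2) - 2 * PI * IZR j).
Proof.
intros Hh0 Hh Hk HkW HWP Heps Hphi Ha Hb Hne.
apply Rnot_lt_le; intros Hlt; apply Hne; clear Hne.
assert (Hk1 : 1 <= INR k) by (apply (le_INR 1); lia).
assert (HkW' : 4 * INR k <= INR W).
{ replace 4 with (INR 4) by (simpl; ring); rewrite <- mult_INR; now apply le_INR. }
assert (Ha' := le_INR _ _ Ha); assert (Hb' := le_INR _ _ Hb).
assert (Ha0 := pos_INR a); assert (Hb0 := pos_INR b).
rewrite <- Hh in Hlt.
replace (h * (INR (s + b) + / 2) - h * INR P * IZR j)
  with (h * (INR (s + b) + / 2 - INR P * IZR j)) in Hlt by ring.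
rewrite Rabs_mult, (Rabs_pos_eq h) in Hlt by lra.
assert (Hab : Rabs (INR (s + b) + / 2 - INR P * IZR j) < INR W / 2).
{ apply (Rmult_lt_reg_l h); [easy|lra]. }
apply Rabs_def2 in Hab; rewrite plus_INR in Hab.
assert (Hz : (- Z.of_nat W <= Z.of_nat s + Z.of_nat a - Z.of_nat P * j <= Z.of_nat W)%Z).
{ split; apply le_IZR; rewrite ?opp_IZR, minus_IZR, plus_IZR, mult_IZR, <- !INR_IZR_INZ; lra. }
(* A negative [j] would give [s + a + P <= W], against [4 * W <= P]; so the quotient exists in
   [nat]. *)
assert (Hj : (0 <= j)%Z) by nia.
apply (Hphi _ (Z.to_nat j) (Z.to_nat (Z.of_nat s + Z.of_nat a - Z.of_nat P * j + Z.of_nat W))).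
- apply Nat2Z.inj; rewrite !Nat2Z.inj_add, Nat2Z.inj_mul, !Z2Nat.id; lia.
- lia.
Qed.

Lemma growth_decay {X : NormedModule C_AbsRing} (T : X -> X) Res m K c :
  is_linear T -> (forall j y, norm (opow T j y) <= K * norm y) -> 0 <= K ->
  resolvent_bound T Res m ->
  (forall eps, 0 < eps <= PI -> 1 <= 2 * (eps * m eps)) -> 0 < c < 1 ->
  exists d eps0, 0 <= d /\ 0 < eps0 /\
    forall eps n x, 0 < eps <= eps0 -> eps <= PI -> (1 <= n)%nat ->
      mlog m eps = c * INR n ->
      norm (minus (opow T n x) (opow T (S n) x)) <= d * eps * norm x.
Proof.
intros HT HK HK0 HR Hm Hc.
destruct (exists_small_exponent c Hc) as [t [Ht Hct]].
(* With [W * h >= A * eps / 2], the cost [beta = 2 k / (W h)] is at most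
   [4 k / (A eps) = t^2 k / (2 eps)], hence at most [t^2 k M] by the lower bound on [eps * M]. *)
set (A := 8 / t ^ 2).
assert (Ht2 : 0 < t ^ 2 <= 1) by (split; [apply pow_lt; lra|]; nra).
assert (HA : 8 <= A).
{ unfold A; apply (Rmult_le_reg_r (t ^ 2)); [easy|].
  unfold Rdiv; rewrite Rmult_assoc, Rinv_l by lra; lra. }
assert (HPI := PI_RGT_0).
(* The bound [eps <= / 2] gives [M / eps >= 2], hence [L >= 1] and [k >= 1]; the bound
   [2 * A * eps <= PI] makes the window fit into the circle, [4 * W <= P]. *)
exists (12 * A * K + 4 * exp (2 + / t) * (1 + K)), (Rmin (/ 2) (PI / (2 * A))).
assert (Hexp := exp_pos (2 + / t)).
split; [|split].
{ assert (0 <= A * K) by nra.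
  assert (0 <= exp (2 + / t) * (1 + K)) by (apply Rmult_le_pos; lra); lra. }
{ apply Rmin_glb_lt; [lra|apply Rdiv_lt_0_compat; lra]. }
intros eps n x He Hepi Hn Hlog.
assert (He1 : eps <= / 2) by (generalize (Rmin_l (/ 2) (PI / (2 * A))); lra).
assert (He2 : 2 * (A * eps) <= PI).
{ assert (H : eps <= PI / (2 * A)) by (generalize (Rmin_r (/ 2) (PI / (2 * A))); lra).
  apply (Rmult_le_compat_l (2 * A)) in H; [|lra].
  replace (2 * A * (PI / (2 * A))) with PI in H by (field; lra); lra. }
set (M := m eps).
assert (HMe : 1 <= 2 * (eps * M)) by (apply Hm; lra).
assert (HM : 0 < M) by nra.
set (L := ln (1 + M / eps)).
assert (HcnL : c * INR n = M * L) by now rewrite <- Hlog.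
assert (HMe' : 2 <= M / eps).
{ apply (Rmult_le_reg_r eps); [lra|]; unfold Rdiv.
  rewrite Rmult_assoc, Rinv_l by lra; nra. }
assert (HexpL : exp L = 1 + M / eps) by (apply exp_ln; lra).
assert (HL : 1 <= L).
{ rewrite <- (ln_exp 1); apply Rcomplements.ln_le; [apply exp_pos|].
  generalize exp_le_3; lra. }
(* Here [L = c n / M], so [k * M <= c * n], and [c <= exp (- (4 * t))] is the slack that
   [rising_decay] asks for. *)
destruct (nfloor_ex L) as [k Hk]; [lra|].
assert (Hk1 : (1 <= k)%nat).
{ destruct k; [simpl in Hk; lra|lia]. }
assert (Hk1' : 1 <= INR k) by (apply (le_INR 1); lia).
assert (Hn0 : 0 < INR n) by (apply lt_0_INR; lia).
destruct (Cmod_1_minus_cis_ge (exp t)) as [x0 [Hx0 Hcis]].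
{ rewrite <- exp_0; apply exp_increasing; lra. }
(* The length [v] drives the mesh: [h] is about [A * eps / (k * v)], so a large [v] brings the
   angles [h * nu] below [x0]. The summand [n + 4] added to it secures [S n < P] and
   [4 * k <= W]. *)
destruct (nfloor_ex (A * eps * (INR n + INR k + 2) / x0)) as [v0 Hv0].
{ left; apply Rdiv_lt_0_compat; [|easy].
  apply Rmult_lt_0_compat; [apply Rmult_lt_0_compat|]; lra. }
set (v := (v0 + n + 4)%nat).
assert (Hv : 4 <= INR v) by (replace 4 with (INR 4) by (simpl; ring); apply le_INR; unfold v; lia).
set (W := (k * v)%nat).
assert (HWkv : INR W = INR k * INR v) by apply mult_INR.
assert (HW1 : 4 <= INR W) by nra.
(* [P] is chosen so that the angular width [W * h] lies between [A * eps / 2] and [A * eps]. *)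
destruct (nfloor_ex (2 * PI * INR W / (A * eps))) as [p Hp].
{ left; apply Rdiv_lt_0_compat; [|apply Rmult_lt_0_compat; lra].
  apply Rmult_lt_0_compat; lra. }
set (P := S p).
assert (HPp : INR P = INR p + 1) by apply S_INR.
assert (HAe : 0 < A * eps) by (apply Rmult_lt_0_compat; lra).
set (z := 2 * PI * INR W / (A * eps)) in *.
assert (Hz : z * (A * eps) = 2 * PI * INR W) by (unfold z; field; lra).
assert (Hz4 : 4 * INR W <= z).
{ apply (Rmult_le_reg_r (A * eps)); [easy|]; rewrite Hz.
  apply Rle_trans with (INR W * (4 * (A * eps))); [right; ring|].
  apply Rle_trans with (INR W * (2 * PI)); [apply Rmult_le_compat_l; lra|right; ring]. }
assert (HP0 : 0 < INR P) by lra.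
set (h := 2 * PI / INR P).
assert (Hh0 : 0 < h) by (apply Rdiv_lt_0_compat; lra).
assert (Hh : h * INR P = 2 * PI) by (unfold h; field; lra).
assert (HWh : INR W * h <= A * eps).
{ apply (Rmult_le_reg_r (INR P)); [easy|].
  apply Rle_trans with (2 * PI * INR W); [right; rewrite <- Hh; ring|].
  rewrite <- Hz, Rmult_comm; apply Rmult_le_compat_l; lra. }
assert (HWh' : A * eps <= 2 * (INR W * h)).
{ apply (Rmult_le_reg_r (INR P)); [easy|].
  apply Rle_trans with (2 * (2 * PI * INR W)); [|right; rewrite <- Hh; ring].
  rewrite <- Hz; apply Rle_trans with (A * eps * (2 * z)); [|right; ring].
  apply Rmult_le_compat_l; lra. }
assert (HWP : (4 * W <= P)%nat).
{ apply INR_le; rewrite mult_INR; replace (INR 4) with 4 by (simpl; ring); lra. }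
assert (HvW : (v <= W)%nat) by (unfold W; nia).
assert (Hsmall : h * (INR n + INR k + 2) < x0).
{ assert (Hvv : INR v0 + 1 <= INR W).
  { rewrite <- S_INR; apply le_INR; unfold v in HvW; lia. }
  apply (Rmult_lt_reg_l (INR W)); [lra|].
  apply Rle_lt_trans with (A * eps * (INR n + INR k + 2)).
  - rewrite <- Rmult_assoc; apply Rmult_le_compat_r; lra.
  - replace (A * eps * (INR n + INR k + 2))
      with (A * eps * (INR n + INR k + 2) / x0 * x0) by (field; lra).
    apply Rmult_lt_compat_r; lra. }
destruct (smooth_cutoff h P k v) as [phi [Hper [Hgrad [Hone Hl1]]]];
  [easy|unfold v; lia|exact HWP|easy|easy|].
fold W in Hone, Hl1.
set (beta := 2 * INR k / (INR W * h)).
assert (HWh0 : 0 < INR W * h) by (apply Rmult_lt_0_compat; lra).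
assert (Hhb : h * beta = 2 / INR v).
{ unfold beta; rewrite HWkv; field; lra. }
assert (Hbeta0 : 0 <= beta).
{ left; apply Rdiv_lt_0_compat; lra. }
assert (HRn : forall s, is_resolvent T (node h s) (Res (node h s))).
{ intros s; apply (node_resolvent T Res m h P); try easy; unfold P; lia. }
eapply Rle_trans.
{ apply (power_difference_decay T Res h P phi n k x K M beta t 2
    (12 * (INR W * h))); try easy; try lra.
  - assert ((S n < 4 * W)%nat) by (unfold v in HvW; lia); lia.
  - split; [easy|].
    apply (Rmult_le_reg_r (INR W * h)); [easy|].
    apply Rle_trans with (2 * INR k); [right; unfold beta; field; lra|].
    apply Rle_trans with (INR k * (t ^ 2 * (M * (A * eps / 2)))).
    + rewrite Rmult_comm; apply Rmult_le_compat_l; [lra|].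
      replace (t ^ 2 * (M * (A * eps / 2))) with (2 * (2 * (eps * M)))
        by (unfold A; field; lra); lra.
    + apply Rle_trans with (t ^ 2 * INR k * M * (A * eps / 2)); [right; ring|].
      apply Rmult_le_compat_l; [repeat apply Rmult_le_pos; lra|lra].
  - apply Rle_trans with (c * INR n); [|apply Rmult_le_compat_r; lra].
    rewrite HcnL, Rmult_comm; apply Rmult_le_compat_l; lra.
  - intros nu Hnu; apply Hcis.
    assert (0 < INR nu) by (apply lt_0_INR; lia).
    assert (INR nu <= INR n + INR k + 2).
    { replace (INR n + INR k + 2) with (INR (n + k + 2)) by (rewrite !plus_INR; simpl; ring).
      apply le_INR; lia. }
    split; nra.
  - intros l s Hl; rewrite Hhb; specialize (Hgrad l s Hl).
    destruct l as [|l].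
    + simpl in *; eapply Rle_trans; [apply Cmod_triangle|].
      rewrite Cmod_opp, Cmod_1; lra.
    + rewrite iter_grad_one_minus, Cmod_opp by lia.
      assert (0 <= (2 / INR v) ^ S l); [|lra].
      apply pow_le; left; apply Rdiv_lt_0_compat; lra.
  - intros s a b Ha Hb Hne; apply HR; [lra|].
    intros j; apply (cutoff_support h P W k phi eps s a b j); try easy.
    + unfold W, v; nia.
    + nra. }
apply Rmult_le_compat_r; [apply norm_ge_0|].
(* The balance behind the logarithm in [mlog]: [exp (- L) = 1 / (1 + M / eps)] trades the prefactor
   [M] for [eps]. *)
assert (HMk : M * exp (1 + / t - INR k) <= exp (2 + / t) * eps).
{ apply Rle_trans with (M * (exp (2 + / t) * exp (- L))).
  - rewrite <- exp_plus; apply Rmult_le_compat_l; [lra|apply exp_le; lra].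
  - rewrite exp_Ropp, HexpL.
    apply (Rmult_le_reg_r (1 + M / eps)); [lra|].
    replace (M * (exp (2 + / t) * / (1 + M / eps)) * (1 + M / eps))
      with (exp (2 + / t) * M) by (field; split; [lra|]; nra).
    replace (exp (2 + / t) * eps * (1 + M / eps))
      with (exp (2 + / t) * (eps + M)) by (field; lra).
    apply Rmult_le_compat_l; lra. }
assert (H1 : 12 * (INR W * h) * K <= 12 * (A * eps) * K) by (apply Rmult_le_compat_r; lra).
assert (H2 : M * exp (1 + / t - INR k) * (1 + K) <= exp (2 + / t) * eps * (1 + K))
  by (apply Rmult_le_compat_r; lra).
lra.
Qed.

(** * Operator norms, the resolvent, and the inverse of [mlog] *)

Lemma opnorm_bound {X : NormedModule C_AbsRing} (A : X -> X) (a : R) :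
  is_linear A -> Rbar_le (opnorm A) a -> forall x, norm (A x) <= a * norm x.
Proof.
intros HA Ha x.
assert (Hle : forall y, norm y <= 1 -> norm (A y) <= a).
{ intros y Hy.
  apply (Rbar_le_trans (norm (A y)) (opnorm A) a); [|exact Ha].
  apply (proj1 (Lub_Rbar_correct _)); now exists y. }
destruct (Req_dec (norm x) 0) as [H0|H0].
{ destruct (linear_norm A HA) as [M [HM HAM]].
  generalize (HAM x); rewrite H0, !Rmult_0_r; easy. }
assert (Hn : 0 < norm x) by (generalize (norm_ge_0 x); lra).
assert (Hc : Cmod (RtoC (/ norm x)) = / norm x).
{ rewrite Cmod_R; apply Rabs_pos_eq; left; now apply Rinv_0_lt_compat. }
assert (Hc' : Cmod (RtoC (norm x)) = norm x) by (rewrite Cmod_R; apply Rabs_pos_eq; lra).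
set (y := scal (RtoC (/ norm x) : C_AbsRing) x).
assert (Hy : norm (A y) <= a).
{ apply Hle; eapply Rle_trans; [apply norm_scal_C|].
  rewrite Hc, Rinv_l by easy; apply Rle_refl. }
assert (Hx : A x = scal (RtoC (norm x) : C_AbsRing) (A y)).
{ unfold y; rewrite (linear_scal A HA), scal_assoc; symmetry.
  etransitivity; [|exact (scal_one (A x))]; f_equal.
  change (RtoC (norm x) * RtoC (/ norm x) = RtoC 1)%C.
  rewrite <- RtoC_mult, Rinv_r by easy; easy. }
rewrite Hx; eapply Rle_trans; [apply norm_scal_C|].
rewrite Hc', Rmult_comm; apply Rmult_le_compat_r; lra.
Qed.

Lemma opnorm_le {X : NormedModule C_AbsRing} (A : X -> X) (a : R) :
  0 <= a -> (forall x, norm (A x) <= a * norm x) -> Rbar_le (opnorm A) a.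
Proof.
intros Ha H; apply (proj2 (Lub_Rbar_correct _)).
intros r [x [Hx ->]]; simpl.
eapply Rle_trans; [apply H|].
rewrite <- (Rmult_1_r a) at 2; now apply Rmult_le_compat_l.
Qed.

Lemma is_linear_opow {X : NormedModule C_AbsRing} (T : X -> X) n :
  is_linear T -> is_linear (opow T n).
Proof.
intros HT; induction n as [|n IH].
- exact is_linear_id.
- exact (is_linear_comp _ _ IH HT).
Qed.

Lemma resolvent_spec {X : CompleteNormedModule C_AbsRing} (T : X -> X) z :
  ~ spectrum T z ->
  is_linear (resolvent z T) /\ is_resolvent T z (resolvent z T).
Proof.
intros Hz; apply NNPP in Hz; destruct Hz as [S [HS [H1 H2]]].
replace (resolvent z T) with S; [exact (conj HS (conj H2 H1))|].
apply functional_extensionality; intros y; symmetry; unfold resolvent.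
apply iota_unique; [|apply H2].
intros x <-; now rewrite H1.
Qed.

Lemma angle_reduction x : exists j : Z, Rabs (x - 2 * PI * IZR j) <= PI.
Proof.
assert (HPI := PI_RGT_0).
exists (Int_part ((x + PI) / (2 * PI))).
destruct (base_Int_part ((x + PI) / (2 * PI))) as [H1 H2].
set (j := IZR (Int_part _)) in *.
assert (Hx : x + PI = 2 * PI * ((x + PI) / (2 * PI))) by (field; lra).
set (u := (x + PI) / (2 * PI)) in *.
assert (0 <= 2 * PI * (u - j)) by (apply Rmult_le_pos; lra).
assert (2 * PI * (u - j) <= 2 * PI * 1) by (apply Rmult_le_compat_l; lra).
apply Rabs_le; lra.
Qed.

Lemma cis_1 theta : 0 < Rabs theta <= PI -> cis theta <> RtoC 1.
Proof.
intros H; apply cis_neq_1; generalize PI_RGT_0; lra.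
Qed.

Lemma resolvent_bound_of_angles {X : CompleteNormedModule C_AbsRing} (T : X -> X) m :
  (forall lambda : C, spectrum T lambda -> Cmod lambda = 1 -> lambda = RtoC 1) ->
  (forall e e', 0 < e <= PI -> 0 < e' <= PI -> e <= e' -> m e' <= m e) ->
  (forall theta, 0 < Rabs theta <= PI -> forall y,
     norm (resolvent (cis theta) T y) <= m (Rabs theta) * norm y) ->
  resolvent_bound T (fun z => resolvent z T) m.
Proof.
intros Hsp Hmono Hb x eps Heps Hx.
destruct (angle_reduction x) as [j Hj].
rewrite <- (cis_period x (- j)).
replace (x + 2 * PI * IZR (- j)) with (x - 2 * PI * IZR j) by (rewrite opp_IZR; ring).
specialize (Hx j); set (theta := x - 2 * PI * IZR j) in *.
split.
- apply resolvent_spec; intros Hs.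
  apply (cis_1 theta); [lra|]; apply Hsp; [easy|apply Cmod_cis].
- intros y; eapply Rle_trans; [apply Hb; lra|].
  apply Rmult_le_compat_r; [apply norm_ge_0|apply Hmono; lra].
Qed.

(** An a priori form of the Neumann argument: [u = Rz y] satisfies [(w - T) u = y + (w - z) u], and
    the last term contributes at most half of [norm u], which is absorbed on the left. *)
Lemma resolvent_perturbation {X : NormedModule C_AbsRing} (T Rz Rw : X -> X) z w a y :
  is_resolvent T z Rz -> is_resolvent T w Rw -> 0 <= a ->
  (forall u, norm (Rw u) <= a * norm u) -> 2 * (a * Cmod (w - z)) <= 1 ->
  norm (Rz y) <= 2 * a * norm y.
Proof.
intros [Hz _] [_ Hw] Ha HRw Hd.
set (u := Rz y).
assert (Hu : shifted w T u = plus y (scal (w - z)%C u)).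
{ rewrite <- (Hz y); fold u; unfold shifted.
  replace (scal (w : C_AbsRing) u) with (plus (scal (z : C_AbsRing) u) (scal (w - z)%C u)).
  - rewrite !minusE, <- !plus_assoc; f_equal; apply plus_comm.
  - etransitivity; [symmetry; exact (scal_distr_r (K := C_Ring) (V := X) z (w - z)%C u)|].
    f_equal; change (z + (w - z) = w)%C; ring. }
assert (Hle : norm u <= a * (norm y + Cmod (w - z) * norm u)).
{ rewrite <- (Hw u) at 1; eapply Rle_trans; [apply HRw|].
  apply Rmult_le_compat_l; [easy|]; rewrite Hu.
  eapply Rle_trans; [apply norm_triangle|].
  apply Rplus_le_compat_l, norm_scal_C. }
assert (Hdu : 2 * (a * Cmod (w - z)) * norm u <= 1 * norm u)
  by (apply Rmult_le_compat_r; [apply norm_ge_0|easy]).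
lra.
Qed.

(* If [2 * (e0 * m e0) < 1] then [1] lies in the resolvent set, so the resolvent
   is bounded on the whole circle. *)
Lemma resolvent_bound_of_small {X : CompleteNormedModule C_AbsRing} (T : X -> X) m e0 :
  (forall lambda : C, spectrum T lambda -> Cmod lambda = 1 -> lambda = RtoC 1) ->
  (forall eps, 0 < eps <= PI -> 0 < m eps) ->
  (forall e e', 0 < e <= PI -> 0 < e' <= PI -> e <= e' -> m e' <= m e) ->
  (forall theta, 0 < Rabs theta <= PI -> forall y,
     norm (resolvent (cis theta) T y) <= m (Rabs theta) * norm y) ->
  0 < e0 <= PI -> 2 * (e0 * m e0) < 1 ->
  resolvent_bound T (fun z => resolvent z T) (fun _ => 2 * m e0).
Proof.
intros Hsp Hpos Hmono Hb He0 Hsm.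
assert (Hm0 := Hpos e0 He0).
apply resolvent_bound_of_angles; [easy|intros; lra|].
intros th Hth y.
assert (Hy := norm_ge_0 y).
destruct (Rle_dec e0 (Rabs th)) as [Hle|Hgt].
{ eapply Rle_trans; [now apply Hb|].
  apply Rmult_le_compat_r; [easy|].
  assert (m (Rabs th) <= m e0) by (apply Hmono; lra); lra. }
assert (Hres : forall t, 0 < Rabs t <= PI ->
  is_resolvent T (cis t) (resolvent (cis t) T)).
{ intros t Ht; apply resolvent_spec; intros Hs.
  apply (cis_1 t Ht), Hsp; [easy|apply Cmod_cis]. }
(* The endpoint of the arc of radius [e0] on the same side as [th], so that the two angles differ by
   at most [e0]. *)
set (s := if Rle_dec 0 th then e0 else - e0).
assert (Hs : Rabs s = e0).
{ unfold s; destruct (Rle_dec 0 th); [apply Rabs_pos_eq; lra|].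
  rewrite Rabs_Ropp; apply Rabs_pos_eq; lra. }
assert (Hd : Rabs (th - s) <= e0).
{ assert (Hgt' : Rabs th < e0) by lra; apply Rabs_def2 in Hgt'.
  unfold s; destruct (Rle_dec 0 th); apply Rabs_le; lra. }
apply (resolvent_perturbation T _ (resolvent (cis s) T) (cis th) (cis s)).
- now apply Hres.
- apply Hres; lra.
- lra.
- intros u; rewrite <- Hs; apply Hb; lra.
- assert (Hc : Cmod (cis s - cis th) <= e0).
  { replace (cis s - cis th)%C with (cis s * (1 - cis (th - s)))%C.
    - rewrite Cmod_mult, Cmod_cis, Rmult_1_l.
      eapply Rle_trans; [apply Cmod_1_minus_cis_le|exact Hd].
    - replace (cis th) with (cis (s + (th - s))) by (f_equal; ring).
      rewrite cis_plus; ring. }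
  assert (m e0 * Cmod (cis s - cis th) <= m e0 * e0) by (apply Rmult_le_compat_l; lra).
  lra.
Qed.

(** * Existence and smallness of the values of [mlog_inv] *)

Lemma mlog_decreasing m e e' :
  (forall eps, 0 < eps <= PI -> 0 < m eps) ->
  (forall eps1 eps2, 0 < eps1 <= PI -> 0 < eps2 <= PI -> eps1 <= eps2 -> m eps2 <= m eps1) ->
  0 < e < e' -> e' <= PI -> mlog m e' < mlog m e.
Proof.
intros Hpos Hmono He He'; unfold mlog.
assert (H1 : m e' <= m e) by (apply Hmono; lra).
assert (H0 : 0 < m e') by (apply Hpos; lra).
assert (Hq : m e' / e' < m e / e).
{ apply Rle_lt_trans with (m e / e').
  - apply Rmult_le_compat_r; [left; apply Rinv_0_lt_compat; lra|easy].
  - apply Rmult_lt_compat_l; [lra|apply Rinv_lt_contravar; nra]. }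
assert (Hq0 : 0 < m e' / e') by (apply Rdiv_lt_0_compat; lra).
assert (Hl : ln (1 + m e' / e') < ln (1 + m e / e)) by (apply ln_increasing; lra).
assert (Hl0 : 0 < ln (1 + m e' / e')) by (rewrite <- ln_1; apply ln_increasing; lra).
nra.
Qed.

Lemma clamp_bounds a b x : a <= b -> a <= Rmax a (Rmin x b) <= b.
Proof.
intros H; split; [apply Rmax_l|apply Rmax_lub; [easy|apply Rmin_r]].
Qed.

Lemma clamp_id a b x : a <= x <= b -> Rmax a (Rmin x b) = x.
Proof. intros H; rewrite Rmin_left, Rmax_right; lra. Qed.

Lemma clamp_contraction a b x y :
  Rabs (Rmax a (Rmin y b) - Rmax a (Rmin x b)) <= Rabs (y - x).
Proof.
unfold Rmax, Rmin.
repeat (destruct (Rle_dec _ _)); apply Rabs_le; unfold Rabs; destruct (Rcase_abs _); lra.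
Qed.

(** The intermediate value theorem [IVT_gen] asks for continuity on the whole line, while [m] is
    controlled only on an interval; the composition with a retraction bridges the gap. *)
Lemma continuous_clamp (D : R -> Prop) m a b : a <= b ->
  continuous_on D m -> (forall x, a <= x <= b -> D x) ->
  continuity (fun x => m (Rmax a (Rmin x b))).
Proof.
intros Hab Hm HD x; apply continuity_pt_filterlim.
set (cl := fun x => Rmax a (Rmin x b)).
apply (filterlim_comp _ _ _ cl m (locally x) (within D (locally (cl x)))).
- intros Q [d Hd]; exists d; intros y Hy.
  apply Hd; [|apply HD, clamp_bounds, Hab].
  eapply Rle_lt_trans; [apply (clamp_contraction a b x y)|exact Hy].
- apply Hm, HD, clamp_bounds, Hab.
Qed.

Lemma mlog_inv_spec m y :
  (forall eps, 0 < eps <= PI -> 0 < m eps) ->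
  continuous_on (fun eps : R => 0 < eps <= PI) m ->
  (forall eps1 eps2, 0 < eps1 <= PI -> 0 < eps2 <= PI -> eps1 <= eps2 -> m eps2 <= m eps1) ->
  mlog m PI <= y ->
  0 < mlog_inv m y <= PI /\ mlog m (mlog_inv m y) = y.
Proof.
intros Hpos Hcont Hmono Hy.
assert (HPI := PI_RGT_0).
apply (iota_correct (V := R_CompleteNormedModule)
  (fun eps => 0 < eps <= PI /\ mlog m eps = y)).
assert (Hmu : 0 < m PI) by (apply Hpos; lra).
assert (Hy0 : 0 < y).
{ eapply Rlt_le_trans; [|exact Hy]; unfold mlog; apply Rmult_lt_0_compat; [easy|].
  assert (0 < m PI / PI) by now apply Rdiv_lt_0_compat.
  rewrite <- ln_1; apply ln_increasing; lra. }
(* Chosen so that [m a / a >= exp (y / m PI)], whence [mlog m a >= m PI * (y / m PI) = y]. *)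
set (a := Rmin PI (m PI * exp (- (y / m PI)))).
assert (Hexp := exp_pos (- (y / m PI))).
assert (Ha : 0 < a <= PI).
{ split; [apply Rmin_glb_lt; [easy|nra]|apply Rmin_l]. }
assert (Hya : y <= mlog m a).
{ unfold mlog.
  assert (Hma : m PI <= m a) by (apply Hmono; lra).
  assert (Ha2 : a <= m PI * exp (- (y / m PI))) by apply Rmin_r.
  assert (Hq : exp (y / m PI) <= m a / a).
  { apply (Rmult_le_reg_r a); [lra|].
    replace (m a / a * a) with (m a) by (field; lra).
    apply Rle_trans with (exp (y / m PI) * (m PI * exp (- (y / m PI)))).
    - apply Rmult_le_compat_l; [left; apply exp_pos|easy].
    - rewrite (Rmult_comm (m PI)), <- Rmult_assoc, <- exp_plus, Rplus_opp_r, exp_0; lra. }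
  assert (Hl : y / m PI <= ln (1 + m a / a)).
  { rewrite <- (ln_exp (y / m PI)); apply Rcomplements.ln_le; [apply exp_pos|lra]. }
  apply Rle_trans with (m PI * (y / m PI)); [right; field; lra|].
  apply Rmult_le_compat; try lra.
  left; apply Rdiv_lt_0_compat; lra. }
set (cl := fun x => Rmax a (Rmin x PI)).
assert (Hcl : forall x, a <= cl x <= PI) by (intros x; apply clamp_bounds; lra).
assert (Hg : continuity (fun x => mlog m (cl x))).
{ assert (Hm1 : continuity (fun x => m (cl x))).
  { apply (continuous_clamp _ m a PI (proj2 Ha) Hcont); intros; lra. }
  assert (Hid : continuity cl).
  { apply (continuous_clamp (fun _ => True) (fun x => x) a PI (proj2 Ha)); [|easy].
    intros x _ Q [d Hd]; exists d; intros z Hz _; now apply Hd. }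
  intros x; unfold mlog; apply continuity_pt_mult; [apply Hm1|].
  apply (continuity_pt_comp (fun x => 1 + m (cl x) / cl x) ln).
  - apply continuity_pt_plus; [apply continuity_pt_const; now intros ? ?|].
    apply continuity_pt_div; [apply Hm1|apply Hid|].
    generalize (Hcl x); lra.
  - apply derivable_continuous_pt; eexists; apply derivable_pt_lim_ln.
    assert (0 < m (cl x) / cl x); [|lra].
    generalize (Hcl x); intros; apply Rdiv_lt_0_compat; [apply Hpos|]; lra. }
destruct (IVT_gen _ a PI y Hg) as [e [He1 He2]].
{ unfold cl; rewrite !clamp_id by lra.
  split; [eapply Rle_trans; [apply Rmin_r|exact Hy]|eapply Rle_trans; [exact Hya|apply Rmax_l]]. }
rewrite Rmin_left, Rmax_right in He1 by lra.
unfold cl in He2; rewrite clamp_id in He2 by lra.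
exists e; split; [split; [lra|easy]|].
intros e' [He' Heq].
destruct (Rtotal_order e e') as [Hlt|[Heq'|Hgt]]; [|easy|].
- generalize (mlog_decreasing m e e' Hpos Hmono ltac:(lra) ltac:(lra)); lra.
- generalize (mlog_decreasing m e' e Hpos Hmono ltac:(lra) ltac:(lra)); lra.
Qed.

Lemma mlog_inv_small m c e1 :
  (forall eps, 0 < eps <= PI -> 0 < m eps) ->
  continuous_on (fun eps : R => 0 < eps <= PI) m ->
  (forall eps1 eps2, 0 < eps1 <= PI -> 0 < eps2 <= PI -> eps1 <= eps2 -> m eps2 <= m eps1) ->
  0 < c -> 0 < e1 <= PI ->
  exists N : nat, forall n : nat, (N <= n)%nat ->
    (1 <= n)%nat /\ 0 < mlog_inv m (c * INR n) <= PI /\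
    mlog_inv m (c * INR n) < e1 /\ mlog m (mlog_inv m (c * INR n)) = c * INR n.
Proof.
intros Hpos Hcont Hmono Hc He1.
assert (Hle : forall e, e1 <= e <= PI -> mlog m e <= mlog m e1).
{ intros e [[He| <-] He']; [|apply Rle_refl].
  left; apply mlog_decreasing; try easy; lra. }
assert (H0 : 0 < mlog m e1).
{ unfold mlog; assert (Hm := Hpos e1 He1).
  assert (0 < m e1 / e1) by (apply Rdiv_lt_0_compat; lra).
  apply Rmult_lt_0_compat; [easy|]; rewrite <- ln_1; apply ln_increasing; lra. }
destruct (nfloor_ex (mlog m e1 / c)) as [N HN].
{ left; now apply Rdiv_lt_0_compat. }
exists (S N); intros n Hn.
assert (Hbig : mlog m e1 < c * INR n).
{ apply le_INR in Hn; rewrite S_INR in Hn.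
  replace (mlog m e1) with (c * (mlog m e1 / c)) by (field; lra).
  apply Rmult_lt_compat_l; lra. }
destruct (mlog_inv_spec m (c * INR n) Hpos Hcont Hmono) as [Hr Heq].
{ generalize (Hle PI ltac:(lra)); lra. }
split; [lia|split; [easy|split; [|easy]]].
apply Rnot_le_lt; intros Hge.
generalize (Hle (mlog_inv m (c * INR n)) ltac:(lra)); lra.
Qed.

(** * From the resolvent estimates to the theorem *)

Lemma opow_shifted {X : NormedModule C_AbsRing} (T : X -> X) n x : is_linear T ->
  opow T n (shifted (RtoC 1) T x) = minus (opow T n x) (opow T (S n) x).
Proof.
intros HT; unfold shifted.
etransitivity; [apply linear_minus, is_linear_opow, HT|].
f_equal; [f_equal; exact (scal_one (K := C_AbsRing) x)|].
unfold opow; now rewrite Nat.iter_succ_r.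
Qed.

(** The decay is exponential with rate close to [1 / M], whereas [mlog_inv] decays at a rate
    governed by [m] near 0. The two are comparable because [m] reaches every fraction [q * M] of the
    bound. *)
Lemma bounded_case {X : NormedModule C_AbsRing} (T : X -> X) Res m M K c :
  is_linear T -> (forall j y, norm (opow T j y) <= K * norm y) -> 0 <= K ->
  (forall eps, 0 < eps <= PI -> 0 < m eps) ->
  continuous_on (fun eps : R => 0 < eps <= PI) m ->
  (forall eps1 eps2, 0 < eps1 <= PI -> 0 < eps2 <= PI -> eps1 <= eps2 -> m eps2 <= m eps1) ->
  0 < M -> resolvent_bound T Res (fun _ => M) ->
  (forall q, 0 < q < 1 -> exists e1, 0 < e1 <= PI /\ q * M <= m e1) -> 0 < c < 1 ->
  exists d N, forall n x, (N <= n)%nat ->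
    0 <= d * mlog_inv m (c * INR n) /\
    norm (minus (opow T n x) (opow T (S n) x)) <= d * mlog_inv m (c * INR n) * norm x.
Proof.
intros HT HK HK0 Hpos Hcont Hmono HM HR Hsup Hc.
(* A number strictly between [c] and 1 divides the loss: [q] is spent on the decay rate and [c / q]
   on the comparison of [M] with [m e]. *)
set (q := (1 + c) / 2).
destruct (circle_bound_decay T Res M K q HT HK HK0 HM HR) as [d [Hd Hdecay]].
{ unfold q; lra. }
destruct (Hsup (c / q)) as [e1 [He1 Hme1]].
{ split; [apply Rdiv_lt_0_compat; unfold q; lra|].
  apply (Rmult_lt_reg_r q); [unfold q; lra|].
  unfold Rdiv; rewrite Rmult_assoc, Rinv_l; unfold q; lra. }
destruct (mlog_inv_small m c e1 Hpos Hcont Hmono (proj1 Hc) He1) as [N HN].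
assert (HPI := PI_RGT_0).
assert (Hmu : 0 < m PI) by (apply Hpos; lra).
exists (d / m PI), N; intros n x Hn.
destruct (HN n Hn) as [Hn1 [He [Hlt Hlog]]].
set (e := mlog_inv m (c * INR n)) in *.
assert (Hdm : 0 <= d / m PI).
{ apply Rmult_le_pos; [easy|left; now apply Rinv_0_lt_compat]. }
split; [apply Rmult_le_pos; lra|].
eapply Rle_trans; [now apply Hdecay|].
apply Rmult_le_compat_r; [apply norm_ge_0|].
replace (d / m PI * e) with (d * (e / m PI)) by (field; lra).
apply Rmult_le_compat_l; [easy|].
assert (Hq : 0 < q) by (unfold q; lra).
assert (Hme : m e1 <= m e) by (apply Hmono; lra).
assert (Hm0 : 0 < m e) by (apply Hpos; lra).
assert (HmPI : m PI <= m e) by (apply Hmono; lra).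
assert (Hme0 : 0 < m e / e) by (apply Rdiv_lt_0_compat; lra).
assert (Hn0 : 0 <= INR n) by apply pos_INR.
assert (Hexp : - (q * INR n / M) <= - ln (1 + m e / e)).
{ apply Ropp_le_contravar.
  apply (Rmult_le_reg_l (m e)); [easy|].
  fold (mlog m e); rewrite Hlog.
  apply Rle_trans with (c / q * M * (q * INR n / M)); [right; field; lra|].
  apply Rmult_le_compat_r; [|lra].
  apply Rmult_le_pos; [nra|left; now apply Rinv_0_lt_compat]. }
eapply Rle_trans; [apply exp_le, Hexp|].
rewrite exp_Ropp, exp_ln by lra.
replace (/ (1 + m e / e)) with (e / (m e + e)) by (field; lra).
apply Rmult_le_compat_l; [lra|apply Rinv_le_contravar; lra].
Qed.

Theorem corollary2p5 :
  forall (X : CompleteNormedModule C_AbsRing) (T : X -> X),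
    is_linear T ->
    power_bounded T ->
    (forall lambda : C, spectrum T lambda -> Cmod lambda = 1 ->
       lambda = RtoC 1) ->
  forall m : R -> R,
    (forall eps : R, 0 < eps <= PI -> 0 < m eps) ->
    continuous_on (fun eps : R => 0 < eps <= PI) m ->
    (forall eps1 eps2 : R, 0 < eps1 <= PI -> 0 < eps2 <= PI ->
       eps1 <= eps2 -> m eps2 <= m eps1) ->
    (forall theta : R, 0 < Rabs theta <= PI ->
       Rbar_le (opnorm (resolvent (cis theta) T)) (m (Rabs theta))) ->
  forall c : R, 0 < c < 1 ->
    exists (K : R) (N : nat), forall n : nat, (N <= n)%nat ->
      Rbar_le (opnorm (fun x : X => opow T n (shifted (RtoC 1) T x)))
              (K * mlog_inv m (c * INR n)).
Proof.
intros X T HT [K0 HK0] Hsp m Hpos Hcont Hmono Hres c Hc.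
assert (HPI := PI_RGT_0).
set (K := Rmax 0 K0).
assert (HK : 0 <= K) by apply Rmax_l.
assert (HTK : forall j y, norm (opow T j y) <= K * norm y).
{ intros j y; eapply Rle_trans.
  - apply (opnorm_bound (opow T j) K0); [now apply is_linear_opow|apply HK0].
  - apply Rmult_le_compat_r; [apply norm_ge_0|apply Rmax_r]. }
assert (Hb : forall theta, 0 < Rabs theta <= PI -> forall y,
  norm (resolvent (cis theta) T y) <= m (Rabs theta) * norm y).
{ intros th Hth; apply opnorm_bound; [|now apply Hres].
  apply resolvent_spec; intros Hs.
  apply (cis_1 th Hth), Hsp; [easy|apply Cmod_cis]. }
assert (HR := resolvent_bound_of_angles T m Hsp Hmono Hb).
enough (H : exists d N, forall n x, (N <= n)%nat ->
  0 <= d * mlog_inv m (c * INR n) /\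
  norm (minus (opow T n x) (opow T (S n) x)) <= d * mlog_inv m (c * INR n) * norm x).
{ destruct H as [d [N H]]; exists d, N; intros n Hn; apply opnorm_le.
  - exact (proj1 (H n zero Hn)).
  - intros x; rewrite opow_shifted by easy; now apply H. }
destruct (classic (exists B, forall e, 0 < e <= PI -> m e <= B)) as [HB|HB].
(* The least upper bound, not just any bound, is required: every fraction [q * M] has to be reached
   by [m]. *)
- destruct (completeness (fun r => exists e, 0 < e <= PI /\ r = m e)) as [M [HM1 HM2]].
  + destruct HB as [B HB]; exists B; intros r [e [He ->]]; now apply HB.
  + exists (m PI), PI; split; [lra|easy].
  + assert (HM : forall e, 0 < e <= PI -> m e <= M).
    { intros e He; apply HM1; now exists e. }
    assert (HM0 : 0 < M).
    { apply Rlt_le_trans with (m PI); [apply Hpos|apply HM]; lra. }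
    apply (bounded_case T (fun z => resolvent z T) m M K c); try easy.
    * intros x eps Heps Hx; destruct (HR x eps Heps Hx) as [HR1 HR2]; split; [easy|].
      intros y; eapply Rle_trans; [apply HR2|].
      apply Rmult_le_compat_r; [apply norm_ge_0|now apply HM].
    * intros q Hq; apply NNPP; intros Hn.
      assert (M <= q * M); [|nra].
      apply HM2; intros r [e [He ->]].
      apply Rnot_lt_le; intros Hlt; apply Hn; exists e; lra.
- destruct (classic (forall e, 0 < e <= PI -> 1 <= 2 * (e * m e))) as [Hg|Hg].
  + destruct (growth_decay T (fun z => resolvent z T) m K c HT HTK HK HR Hg Hc)
      as [d [e0 [Hd [He0 H]]]].
    destruct (mlog_inv_small m c (Rmin PI e0) Hpos Hcont Hmono (proj1 Hc)) as [N HN].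
    { split; [now apply Rmin_glb_lt|apply Rmin_l]. }
    exists d, N; intros n x Hn; destruct (HN n Hn) as [Hn1 [He [Hlt Hlog]]].
    assert (Hr := Rmin_r PI e0).
    split; [apply Rmult_le_pos; lra|].
    apply H; [lra|lra|easy|easy].
  + apply not_all_ex_not in Hg; destruct Hg as [e0 Hg].
    apply imply_to_and in Hg; destruct Hg as [He0 Hg]; apply Rnot_le_lt in Hg.
    assert (Hm0 := Hpos e0 He0).
    (* Here [m] is unbounded, so it exceeds [2 * m e0] somewhere, as [bounded_case] demands. *)
    apply (bounded_case T (fun z => resolvent z T) m (2 * m e0) K c); try easy; [lra| |].
    * now apply resolvent_bound_of_small.
    * intros q Hq; apply NNPP; intros Hn; apply HB; exists (2 * m e0).
      intros e He; apply Rnot_lt_le; intros Hlt; apply Hn; exists e; nra.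
Qed.
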